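(* Let $X$ be a quasi-convex metric space with quasi-convexity constant $C$ such that $\pi_1^{\mathrm{Lip}}(X)=0$, and let $Y$ be a purely $2$-unrectifiable metric space. Then every Lipschitz map $f:X\to Y$ factors through a metric tree: there exist a metric tree $Z$, a $C\,\mathrm{Lip}(f)$-Lipschitz map $\psi:X\to Z$ and a $1$-Lipschitz map $\varphi:Z\to Y$ with $f=\varphi\circ\psi$.
   Context: A metric space $(X,d)$ is quasi-convex with constant $C$ if any $x,x'\in X$ can be joined by a curve of length at most $C\,d(x,x')$. $\pi_1^{\mathrm{Lip}}(X)=0$ means every Lipschitz loop $S^1\to X$ extends to a Lipschitz map of the closed disc $D^2\to X$ (equivalently is Lipschitz null-homotopic). $Y$ is purely $2$-unrectifiable if $\mathcal{H}^2(\varrho(A))=0$ for every Borel set $A\subset\mathbb{R}^2$ and every Lipschitz map $\varrho:A\to Y$. A metric tree is a geodesic metric space in which every geodesic triangle is isometric to a tripod. *)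

(* Defs.v *)
From Stdlib Require Import Reals List.
From Stdlib Require Export Rlimit.
Open Scope R_scope.

Definition R2 := (R * R)%type.
Definition eucl (p q : R2) : R :=
  sqrt ((fst p - fst q)^2 + (snd p - snd q)^2).
Definition in_circle (p : R2) : Prop := (fst p)^2 + (snd p)^2 = 1.
Definition in_disc (p : R2) : Prop := (fst p)^2 + (snd p)^2 <= 1.

Definition lipschitz (X Y : Metric_Space) (f : Base X -> Base Y) (L : R) : Prop :=
  0 <= L /\ forall x x', dist Y (f x) (f x') <= L * dist X x x'.

Definition is_lip_const (X Y : Metric_Space) (f : Base X -> Base Y) (L : R) : Prop :=
  (forall L', lipschitz X Y f L' -> L <= L') /\
  (forall M, (forall L', lipschitz X Y f L' -> M <= L') -> M <= L).

Definition lipschitz_on_R2 (Y : Metric_Space) (A : R2 -> Prop) (g : R2 -> Base Y) (L : R) : Prop :=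
  0 <= L /\ forall p q, A p -> A q -> dist Y (g p) (g q) <= L * eucl p q.

Definition continuous_on_interval (X : Metric_Space) (a b : R) (g : R -> Base X) : Prop :=
  forall t, a <= t <= b -> forall eps, eps > 0 -> exists del, del > 0 /\
    forall s, a <= s <= b -> Rabs (s - t) < del -> dist X (g s) (g t) < eps.

Fixpoint poly_length (X : Metric_Space) (g : R -> Base X) (t0 : R) (l : list R) : R :=
  match l with
  | nil => 0
  | t1 :: l' => dist X (g t0) (g t1) + poly_length X g t1 l'
  end.

Fixpoint increasing_from (t0 : R) (l : list R) : Prop :=
  match l with
  | nil => True
  | t1 :: l' => t0 <= t1 /\ increasing_from t1 l'
  end.

(* partitions a = t0 <= t1 <= ... <= tn = b, given by the list [t1;...;tn] *)
Definition partition (a b : R) (l : list R) : Prop :=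
  increasing_from a l /\ last l a = b.

Definition length_le (X : Metric_Space) (a b : R) (g : R -> Base X) (L : R) : Prop :=
  forall l, partition a b l -> poly_length X g a l <= L.

Definition quasi_convex (X : Metric_Space) (C : R) : Prop :=
  forall x x' : Base X, exists (a b : R) (g : R -> Base X),
    a <= b /\ continuous_on_interval X a b g /\ g a = x /\ g b = x' /\
    length_le X a b g (C * dist X x x').

Definition lip_simply_connected (X : Metric_Space) : Prop :=
  forall (g : R2 -> Base X) (L : R), lipschitz_on_R2 X in_circle g L ->
    exists (F : R2 -> Base X) (L' : R),
      lipschitz_on_R2 X in_disc F L' /\ (forall p, in_circle p -> F p = g p).

Definition open_R2 (U : R2 -> Prop) : Prop :=
  forall p, U p -> exists r, r > 0 /\ forall q, eucl p q < r -> U q.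

Inductive borel_R2 : (R2 -> Prop) -> Prop :=
  | borel_open : forall U, open_R2 U -> borel_R2 U
  | borel_compl : forall A, borel_R2 A -> borel_R2 (fun p => ~ A p)
  | borel_union : forall (A : nat -> R2 -> Prop),
      (forall n, borel_R2 (A n)) -> borel_R2 (fun p => exists n, A n p)
  | borel_ext : forall A B, borel_R2 A -> (forall p, A p <-> B p) -> borel_R2 B.

Definition diam_le (Y : Metric_Space) (U : Base Y -> Prop) (r : R) : Prop :=
  forall a b, U a -> U b -> dist Y a b <= r.

(* H^2(S) = 0 iff H^2_delta(S) = 0 for every delta > 0 *)
Definition hausdorff2_null (Y : Metric_Space) (S : Base Y -> Prop) : Prop :=
  forall delta eps, delta > 0 -> eps > 0 ->
    exists (U : nat -> Base Y -> Prop) (r : nat -> R),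
      (forall n, 0 <= r n /\ r n <= delta /\ diam_le Y (U n) (r n)) /\
      (forall y, S y -> exists n, U n y) /\
      (forall N, sum_f_R0 (fun n => (r n)^2) N <= eps).

Definition purely_2_unrectifiable (Y : Metric_Space) : Prop :=
  forall (A : R2 -> Prop) (rho : R2 -> Base Y) (L : R),
    borel_R2 A -> lipschitz_on_R2 Y A rho L ->
    hausdorff2_null Y (fun y => exists p, A p /\ rho p = y).

Definition geodesic (X : Metric_Space) (x y : Base X) (g : R -> Base X) : Prop :=
  g 0 = x /\ g (dist X x y) = y /\
  forall s t, 0 <= s <= dist X x y -> 0 <= t <= dist X x y ->
    dist X (g s) (g t) = Rabs (s - t).

Definition geodesic_space (X : Metric_Space) : Prop :=
  forall x y, exists g, geodesic X x y g.

(* Tripod with legs of lengths a.(0), a.(1), a.(2) >= 0: points (i,t), i<3,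
   0 <= t <= leg i, all points (i,0) being the centre (distance 0). *)
Definition tripod_pt (leg : nat -> R) (q : nat * R) : Prop :=
  (fst q < 3)%nat /\ 0 <= snd q <= leg (fst q).
Definition tripod_dist (q q' : nat * R) : R :=
  if Nat.eqb (fst q) (fst q') then Rabs (snd q - snd q') else snd q + snd q'.

Definition isometric_to_tripod (X : Metric_Space) (T : Base X -> Prop) : Prop :=
  exists (leg : nat -> R) (phi : Base X -> nat * R),
    (forall i, 0 <= leg i) /\
    (forall p, T p -> tripod_pt leg (phi p)) /\
    (forall p p', T p -> T p' -> dist X p p' = tripod_dist (phi p) (phi p')) /\
    (forall q, tripod_pt leg q -> exists p, T p /\ tripod_dist (phi p) q = 0).

Definition metric_tree (Z : Metric_Space) : Prop :=
  geodesic_space Z /\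
  forall (x y z : Base Z) (g1 g2 g3 : R -> Base Z),
    geodesic Z x y g1 -> geodesic Z y z g2 -> geodesic Z z x g3 ->
    isometric_to_tripod Z (fun p =>
      (exists t, 0 <= t <= dist Z x y /\ g1 t = p) \/
      (exists t, 0 <= t <= dist Z y z /\ g2 t = p) \/
      (exists t, 0 <= t <= dist Z z x /\ g3 t = p)).

(* Main.v *)
Require Import Defs.
From Stdlib Require Import Reals Lra Lia List Bool.
From Stdlib Require Import Classical ClassicalEpsilon FunctionalExtensionality PropExtensionality ProofIrrelevance.
Open Scope R_scope.

(* Call two points of X equivalent if they are joined by Lipschitz paths along which f is almost constant.
   Fill the loop formed by two paths from x to y by a Lipschitz disc.  Its image in Y is H^2-null, so by
   Eilenberg's inequality the distance to f x has levels t at which the part of the image lying over t is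
   covered by sets of small total diameter.  A connected piece of such a level separates x from y in the
   disc, so it joins the two paths, and f is almost constant on it.  Applied to the last exit times from
   the sublevel components of x, this yields a point whose class is met by every path from x to y.  Hence
   any two inequivalent points are separated by a third, the cut points between x and y are linearly
   ordered without gaps, and three points have a median.  The tree is X with the length of f along the
   cut points as distance; defining it by chains of small steps, no path in X has to realize it. *)

(** Limits of paths need not exist in [X]. This is why [eqv] asks for an almost constant path at
    every scale instead of one path with constant image. Compactness enters only through parameter
    intervals and the parameter square: on a single path, avoiding a class becomes avoiding it by a
    uniform margin, and this makes cut points closed under limits. Level sets in a Lipschitz disc
    can be wild, so separation is shown on a grid by a parity count in place of a theorem of plane
    topology. Nullity is used in a finite quantitative form: a small sum of squared diameters forces
    a small sum of diameters at some level. The constant [C * Lf] appears when a path of length at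
    most [C] times the distance is cut into small steps, whose images have total length at most [Lf]
    times that. The second factor is 1-Lipschitz because a chain in [Y] is at least as long as the
    distance of its ends. *)

(** * Suprema and compactness of intervals and squares *)

Lemma sup_approx (E : R -> Prop) (b : R) :
  (exists s, E s) -> (forall s, E s -> s <= b) ->
  exists m, (forall s, E s -> s <= m) /\ m <= b /\ forall rho, rho > 0 -> exists s, E s /\ m - rho < s.
Proof.
  intros He Hb. destruct (completeness E) as [m [Hub Hlub]]; auto.
  { exists b. exact Hb. }
  exists m. split; [exact Hub|]. split; [now apply Hlub|].
  intros rho Hrho. apply NNPP; intro K. assert (m <= m - rho); [|lra].
  apply Hlub. intros t Et. apply Rnot_lt_le. intro. apply K. now exists t.
Qed.

Lemma inf_approx (E : R -> Prop) (b : R) :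
  (exists s, E s) -> (forall s, E s -> b <= s) ->
  exists m, (forall s, E s -> m <= s) /\ b <= m /\ forall rho, rho > 0 -> exists s, E s /\ s < m + rho.
Proof.
  intros [s Hs] Hb. destruct (sup_approx (fun s => E (- s)) (- b)) as [m [H1 [H2 H3]]].
  - exists (- s). now rewrite Ropp_involutive.
  - intros t Ht. specialize (Hb _ Ht). lra.
  - exists (- m). split; [|split; [lra|]].
    + intros t Ht. assert (- t <= m) by (apply H1; now rewrite Ropp_involutive). lra.
    + intros rho Hrho. destruct (H3 rho Hrho) as [t [Ht Ht']]. exists (- t). split; auto. lra.
Qed.

(** Continuous induction: the supremum [m] of the points reached from [a] is passed unless it is
    [b], since a short interval straddling [m] is good. *)
Lemma interval_chaining (good : R -> R -> Prop) (a b : R) :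
  a <= b ->
  (forall x y z, a <= x <= y -> y <= z <= b -> good x y -> good y z -> good x z) ->
  (forall x, a <= x <= b -> exists del, del > 0 /\
    forall u v, a <= u <= v -> v <= b -> x - del < u -> v < x + del -> good u v) ->
  good a b.
Proof.
  intros Hab Hadd Hloc.
  set (E := fun t => a <= t <= b /\ good a t).
  assert (Ea : E a).
  { destruct (Hloc a) as [d [Hd H]]; [lra|]. split; [lra|]. apply H; lra. }
  destruct (sup_approx E b) as [m [Hub [Hmb Happ]]].
  { now exists a. }
  { intros t [Ht _]; lra. }
  assert (Hm : a <= m <= b) by (split; auto).
  destruct (Hloc m Hm) as [d [Hd H]].
  destruct (Happ d Hd) as [t [[Ht Et] Htm]].
  assert (t <= m) by now apply Hub.
  set (v := Rmin b (m + d / 2)).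
  assert (Hv : v <= b /\ v <= m + d / 2) by (unfold v; split; [apply Rmin_l|apply Rmin_r]).
  assert (Hmv : m <= v) by (apply Rmin_glb; lra).
  assert (Ev : E v).
  { split; [lra|]. apply Hadd with t; try lra; auto. apply H; lra. }
  assert (v <= m) by now apply Hub.
  assert (v = b).
  { unfold v, Rmin in *. destruct (Rle_dec b (m + d/2)); lra. }
  rewrite <- H2. apply Ev.
Qed.

(** A positive parameter found locally can be chosen once for the whole interval, because [P]
    survives shrinking it and two adjacent intervals can share the smaller value. *)
Lemma uniform_on_interval (P : R -> R -> Prop) (a b : R) :
  (forall del del' s, 0 < del' <= del -> P del s -> P del' s) ->
  (forall s, a <= s <= b -> exists rho del, rho > 0 /\ del > 0 /\
     forall s', a <= s' <= b -> Rabs (s' - s) < rho -> P del s') ->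
  exists del, del > 0 /\ forall s, a <= s <= b -> P del s.
Proof.
  intros Hmon Hloc.
  destruct (Rle_or_lt a b) as [Hab|Hab].
  2:{ exists 1. split; [lra|]. intros; lra. }
  apply (interval_chaining (fun u v => exists del, del > 0 /\ forall s, u <= s <= v -> P del s)); auto.
  - intros x y z Hx Hz [d1 [Hd1 H1]] [d2 [Hd2 H2]].
    assert (0 < Rmin d1 d2) by (apply Rmin_glb_lt; lra).
    exists (Rmin d1 d2). split; [lra|]. intros s Hs.
    destruct (Rle_or_lt s y).
    + apply Hmon with d1; [split; [lra|apply Rmin_l]|]. apply H1; lra.
    + apply Hmon with d2; [split; [lra|apply Rmin_r]|]. apply H2; lra.
  - intros x Hx. destruct (Hloc x Hx) as [rho [del [Hr [Hd H]]]].
    exists rho. split; auto. intros u v Hu Hv Hxu Hxv. exists del. split; auto.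
    intros s Hs. apply H; [lra|]. apply Rabs_def1; lra.
Qed.

(** A tube argument: chaining in [t] covers a strip around each line of constant [s] by finitely
    many sets, and chaining in [s] joins the strips. Finiteness is encoded as a bound on the
    index. *)
Lemma square_finite_subcover (O : nat -> R -> R -> Prop) :
  (forall n s t, O n s t -> exists rho, rho > 0 /\
     forall s' t', Rabs (s' - s) < rho -> Rabs (t' - t) < rho -> O n s' t') ->
  (forall s t, 0 <= s <= 1 -> 0 <= t <= 1 -> exists n, O n s t) ->
  exists N, forall s t, 0 <= s <= 1 -> 0 <= t <= 1 -> exists n, (n <= N)%nat /\ O n s t.
Proof.
  intros Hop Hcov.
  apply (interval_chaining (fun u v => exists N, forall s t, u <= s <= v -> 0 <= t <= 1 ->
    exists n, (n <= N)%nat /\ O n s t)); [lra| |].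
  - intros x y z _ _ [N1 H1] [N2 H2]. exists (max N1 N2). intros s t Hs Ht.
    destruct (Rle_or_lt s y) as [Hy|Hy].
    + destruct (H1 s t) as [n [Hn Hn']]; try lra. exists n; split; [lia|auto].
    + destruct (H2 s t) as [n [Hn Hn']]; try lra. exists n; split; [lia|auto].
  - intros x Hx.
    destruct (interval_chaining (fun u v => exists N rho, rho > 0 /\
      forall s t, Rabs (s - x) < rho -> u <= t <= v -> exists n, (n <= N)%nat /\ O n s t) 0 1)
      as [N [rho [Hrho H]]]; [lra| | |].
    + intros u v z _ _ [N1 [r1 [Hr1 H1]]] [N2 [r2 [Hr2 H2]]].
      exists (max N1 N2), (Rmin r1 r2). split; [apply Rmin_glb_lt; lra|].
      intros s t Hs Ht.
      assert (Rabs (s - x) < r1) by (eapply Rlt_le_trans; [exact Hs|apply Rmin_l]).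
      assert (Rabs (s - x) < r2) by (eapply Rlt_le_trans; [exact Hs|apply Rmin_r]).
      destruct (Rle_or_lt t v) as [Hy|Hy].
      * destruct (H1 s t) as [n [Hn Hn']]; try lra; auto. exists n; split; [lia|auto].
      * destruct (H2 s t) as [n [Hn Hn']]; try lra; auto. exists n; split; [lia|auto].
    + intros y Hy. destruct (Hcov x y Hx Hy) as [n Hn].
      destruct (Hop n x y Hn) as [rho [Hrho H]].
      exists rho. split; auto. intros u v Hu Hv Hyu Hyv. exists n, rho. split; auto.
      intros s t Hs Ht. exists n. split; [lia|]. apply H; auto. apply Rabs_def1; lra.
    + exists rho. split; auto. intros u v Hu Hv Hxu Hxv. exists N. intros s t Hs Ht.
      apply H; auto. apply Rabs_def1; lra.
Qed.

(** * Separation in a two-coloured grid *)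

(** Equality and diagonal neighbours are included, so that any two corners of a grid square are
    close; the parity count relies on this. *)
Definition close_idx (i i' : nat) : Prop := (i <= S i')%nat /\ (i' <= S i)%nat.

Definition frontier_vertex (M N : nat) (w : nat -> nat -> bool) (i j : nat) : Prop :=
  (i <= M)%nat /\ (j <= N)%nat /\ w i j = true /\
  exists i' j', (i' <= M)%nat /\ (j' <= N)%nat /\ close_idx i i' /\ close_idx j j' /\ w i' j' = false.

Fixpoint xor_sum (h : nat -> bool) (m : nat) : bool :=
  match m with O => false | S m' => xorb (xor_sum h m') (h m') end.

Lemma xor_sum_true h m : xor_sum h m = true -> exists i, (i < m)%nat /\ h i = true.
Proof.
  induction m; simpl; [discriminate|]. intro H.
  destruct (h m) eqn:E.
  - exists m; split; [lia|auto].
  - rewrite xorb_false_r in H. destruct (IHm H) as [i [Hi E']]. exists i; split; [lia|auto].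
Qed.

(* Call an edge of the grid mixed if its endpoints have different colours.  Each square has an even number of
   mixed edges whose white endpoint satisfies P, and the left and right columns have no mixed edge, so the
   parity of the number of such edges is the same in all rows; in the top row it is odd. *)
Lemma frontier_crosses_grid (M N : nat) (w : nat -> nat -> bool) (P : nat -> nat -> Prop) :
  (forall j, (j <= N)%nat -> w 0%nat j = true) ->
  (forall j, (j <= N)%nat -> w M j = false) ->
  (forall i, frontier_vertex M N w i N -> P i N) ->
  (forall i j i' j', close_idx i i' -> close_idx j j' ->
     frontier_vertex M N w i j -> frontier_vertex M N w i' j' -> P i j -> P i' j') ->
  exists i, frontier_vertex M N w i 0 /\ P i 0%nat.
Proof.
  intros HL HR Htop Hclosed.
  set (p := fun i j => if excluded_middle_informative (P i j) then true else false).
  set (h := fun i j => xorb (w i j) (w (S i) j) && (if w i j then p i j else p (S i) j)).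
  set (v := fun i j => xorb (w i j) (w i (S j)) && (if w i j then p i j else p i (S j))).
  assert (Hfv : forall i j i' j', (i <= M)%nat -> (j <= N)%nat -> (i' <= M)%nat -> (j' <= N)%nat ->
    close_idx i i' -> close_idx j j' -> w i j = true -> w i' j' = false -> frontier_vertex M N w i j).
  { intros. repeat split; auto. now exists i', j'. }
  assert (Hp : forall i j i' j', close_idx i i' -> close_idx j j' ->
     frontier_vertex M N w i j -> frontier_vertex M N w i' j' -> p i j = p i' j').
  { intros. unfold p. destruct (excluded_middle_informative (P i j)), (excluded_middle_informative (P i' j')); auto.
    - exfalso; eauto.
    - exfalso. apply n. apply (Hclosed i' j' i j); auto; unfold close_idx in *; lia. }
  (* In a square with both colours the white corners are frontier vertices close to each other, so
     [P] holds at all of them or at none when they must be compared; the counted edges are then an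
     even number, like the colour changes around the square. *)
  assert (Hsq : forall i j, (S i <= M)%nat -> (S j <= N)%nat ->
     xorb (xorb (h i j) (h i (S j))) (xorb (v i j) (v (S i) j)) = false).
  { intros i j Hi Hj. unfold h, v.
    assert (C0 : forall k, close_idx k k) by (unfold close_idx; lia).
    assert (C1 : forall k, close_idx k (S k)) by (unfold close_idx; lia).
    assert (C2 : forall k, close_idx (S k) k) by (unfold close_idx; lia).
    assert (Hi' : (i <= M)%nat) by lia. assert (Hj' : (j <= N)%nat) by lia.
    destruct (w i j) eqn:E00, (w (S i) j) eqn:E10, (w i (S j)) eqn:E01, (w (S i) (S j)) eqn:E11; simpl; auto;
    repeat match goal with
    | |- context [p ?a ?b] =>
       match goal with
       | |- context [p ?c ?d] =>
         first [constr_eq a c; constr_eq b d; fail 1 |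
           rewrite (Hp a b c d) by (first [solve [auto]
             | solve [apply (Hfv _ _ i j); auto] | solve [apply (Hfv _ _ (S i) j); auto]
             | solve [apply (Hfv _ _ i (S j)); auto] | solve [apply (Hfv _ _ (S i) (S j)); auto]])]
       end
    end; repeat rewrite ?xorb_nilpotent, ?xorb_false_r, ?xorb_false_l; auto;
    repeat match goal with |- context [p ?a ?b] => destruct (p a b) end; auto. }
  set (X := fun j => xor_sum (fun i => h i j)).
  (* Adding up the squares between two rows, every inner vertical edge occurs twice and cancels. *)
  assert (HX : forall j m, (m <= M)%nat -> (S j <= N)%nat -> xorb (X j m) (X (S j) m) = xorb (v 0%nat j) (v m j)).
  { intros j m. induction m; intros Hm Hj.
    - simpl. now rewrite xorb_nilpotent.
    - assert (E := IHm ltac:(lia) Hj). assert (E' := Hsq m j Hm Hj). unfold X in *. simpl.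
      destruct (xor_sum (fun i => h i j) m), (xor_sum (fun i => h i (S j)) m), (h m j), (h m (S j)),
        (v 0%nat j), (v m j), (v (S m) j); simpl in *; congruence. }
  assert (HXM : forall j, (S j <= N)%nat -> X j M = X (S j) M).
  { intros j Hj. assert (E := HX j M (le_n _) Hj). apply xorb_eq. rewrite E.
    unfold v. rewrite !HL, !HR by lia. reflexivity. }
  (* In the top row [P] holds at every frontier vertex, so all mixed edges count and their parity is
     the colour change between the ends. *)
  assert (Htop' : forall m, (m <= M)%nat -> X N m = xorb (w 0%nat N) (w m N)).
  { induction m; intros Hm.
    - simpl. now rewrite xorb_nilpotent.
    - unfold X in *. simpl. rewrite IHm by lia. unfold h.
      assert (forall i i', (i <= M)%nat -> (i' <= M)%nat -> close_idx i i' -> w i N = true -> w i' N = false -> p i N = true).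
      { intros i i' ? ? ? ? ?. unfold p. destruct (excluded_middle_informative (P i N)) as [|n]; auto.
        exfalso. apply n. apply Htop. apply (Hfv i N i' N); auto; unfold close_idx; lia. }
      destruct (w m N) eqn:E, (w (S m) N) eqn:E'; simpl; rewrite ?xorb_false_r; auto.
      + rewrite (H m (S m)) by (auto; unfold close_idx; lia). now destruct (w 0%nat N).
      + rewrite (H (S m) m) by (auto; unfold close_idx; lia). now destruct (w 0%nat N). }
  assert (H0 : X 0%nat M = true).
  { assert (forall j, (j <= N)%nat -> X (N - j)%nat M = true).
    { induction j; intros Hj.
      - rewrite Nat.sub_0_r, Htop' by lia. rewrite HL, HR by lia. reflexivity.
      - rewrite HXM by lia. replace (S (N - S j)) with (N - j)%nat by lia. apply IHj; lia. }
    specialize (H N (le_n _)). now rewrite Nat.sub_diag in H. }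
  destruct (xor_sum_true _ _ H0) as [i [Hi E]]. unfold h in E. apply andb_prop in E as [E1 E2].
  assert (Pp : forall k l, p k l = true -> P k l).
  { intros k l. unfold p. destruct (excluded_middle_informative (P k l)); auto; discriminate. }
  destruct (w i 0%nat) eqn:Ew, (w (S i) 0%nat) eqn:Ew'; try discriminate.
  - exists i. split; [|auto]. apply (Hfv i 0%nat (S i) 0%nat); auto; unfold close_idx; lia.
  - exists (S i). split; [|auto]. apply (Hfv (S i) 0%nat i 0%nat); auto; unfold close_idx; lia.
Qed.

(** * Finite sums, chains through a cover, and levels of small total diameter *)

Definition lsum (g : nat -> R) (l : list nat) : R := fold_right (fun n s => g n + s) 0 l.

Lemma lsum_app g l l' : lsum g (l ++ l') = lsum g l + lsum g l'.
Proof. induction l; simpl; [lra|]. rewrite IHl. lra. Qed.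

Lemma lsum_le g h l : (forall n, In n l -> g n <= h n) -> lsum g l <= lsum h l.
Proof.
  induction l; simpl; intros H; [lra|].
  specialize (IHl (fun n Hn => H n (or_intror Hn))). specialize (H a (or_introl eq_refl)). lra.
Qed.

Lemma lsum_lin g h a b l : lsum (fun n => a * g n + b * h n) l = a * lsum g l + b * lsum h l.
Proof. induction l; simpl; [lra|]. rewrite IHl. lra. Qed.

Lemma lsum_nonneg g l : (forall n, 0 <= g n) -> 0 <= lsum g l.
Proof. intro H. induction l; simpl; [lra|]. specialize (H a). lra. Qed.

Lemma lsum_filter g (q : nat -> bool) l :
  lsum g (filter q l) = lsum (fun n => if q n then g n else 0) l.
Proof. induction l; simpl; auto. destruct (q a); simpl; lra. Qed.

Lemma lsum_const c l : lsum (fun _ => c) l = c * INR (length l).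
Proof.
  induction l; [simpl; lra|]. change (length (a :: l)) with (S (length l)). rewrite S_INR. simpl lsum.
  rewrite IHl. lra.
Qed.

Lemma lsum_seq g N : lsum g (seq 0 (S N)) = sum_f_R0 g N.
Proof.
  induction N; [simpl; lra|]. rewrite seq_S, lsum_app, IHN. simpl. lra.
Qed.

Fixpoint short_steps (Y : Metric_Space) (mu : R) (p : Base Y) (l : list (Base Y)) : Prop :=
  match l with
  | nil => True
  | q :: l' => dist Y p q <= mu /\ short_steps Y mu q l'
  end.

Lemma last_cons_dflt {A} (q p : A) l : last (q :: l) p = last l q.
Proof.
  revert q p. induction l as [|a l IH]; intros q p; [reflexivity|].
  change (last (q :: a :: l) p) with (last (a :: l) p). now rewrite !IH.
Qed.

Lemma short_steps_app Y mu l p l' :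
  short_steps Y mu p (l ++ l') -> short_steps Y mu p l /\ short_steps Y mu (last l p) l'.
Proof.
  revert p. induction l as [|q l IH]; simpl; intros p H; auto.
  destruct H as [H1 H2]. destruct (IH q H2) as [H3 H4]. repeat split; auto.
  change (short_steps Y mu (last (q :: l) p) l'). now rewrite last_cons_dflt.
Qed.

Lemma last_occurrence {A} (P : A -> Prop) (l : list A) :
  (forall q, In q l -> ~ P q) \/ exists l1 q l2, l = l1 ++ q :: l2 /\ P q /\ forall r, In r l2 -> ~ P r.
Proof.
  induction l as [|x l IH]; [left; simpl; tauto|].
  destruct IH as [H|[l1 [q [l2 [E [Hq H]]]]]].
  - destruct (classic (P x)).
    + right. exists nil, x, l. auto.
    + left. intros q [<-|Hq]; auto.
  - right. exists (x :: l1), q, l2. subst. auto.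
Qed.

(* After erasing loops, the chain visits each U_n at most once. *)
Lemma chain_end_dist (Y : Metric_Space) (U : nat -> Base Y -> Prop) (rho : nat -> R) (mu : R) :
  0 <= mu -> (forall n, 0 <= rho n) -> (forall n, diam_le Y (U n) (rho n)) ->
  forall k J l p, length J = k ->
  (forall q, In q (p :: l) -> exists n, In n J /\ U n q) ->
  short_steps Y mu p l ->
  dist Y p (last l p) <= lsum (fun n => rho n + mu) J.
Proof.
  intros Hmu Hrho HU. induction k as [|k IH]; intros J l p HJ Hin Hl.
  - destruct J; [|discriminate]. destruct (Hin p (or_introl eq_refl)) as [n [[] _]].
  - destruct (Hin p (or_introl eq_refl)) as [n [Hn Hp]].
    destruct (in_split n J Hn) as [J1 [J2 ->]].
    assert (HJ' : length (J1 ++ J2) = k) by (rewrite length_app in *; simpl in *; lia).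
    assert (E : lsum (fun n => rho n + mu) (J1 ++ n :: J2)
       = rho n + mu + lsum (fun n => rho n + mu) (J1 ++ J2)).
    { rewrite !lsum_app. simpl. lra. }
    rewrite E.
    assert (Hpos : 0 <= lsum (fun n => rho n + mu) (J1 ++ J2)).
    { apply lsum_nonneg. intro m. specialize (Hrho m). lra. }
    (* Jumping from [p] to the last point [q] of the chain in [U n] costs [rho n], and the next step
       costs [mu]. What remains avoids [U n], so the induction continues with [n] removed from
       [J]. *)
    destruct (last_occurrence (U n) (p :: l)) as [H|[l1 [q [l2 [El [Hq H]]]]]].
    { exfalso. apply (H p); simpl; auto. }
    assert (Hs : short_steps Y mu p (l1 ++ q :: l2) ).
    { rewrite <- El. simpl. split; auto. replace (dist Y p p) with 0; auto.
      symmetry. now apply dist_refl. }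
    assert (Elast : last l p = last l2 q).
    { rewrite <- (last_cons_dflt p p l), El.
      rewrite <- (last_cons_dflt q p l2). clear.
      induction l1 as [|x l1 IH]; [reflexivity|]. rewrite <- IH. simpl.
      destruct (l1 ++ q :: l2) eqn:Ea; [now destruct l1|reflexivity]. }
    apply short_steps_app in Hs as [_ Hs]. simpl in Hs. destruct Hs as [_ Hs].
    assert (Hpq : dist Y p q <= rho n) by now apply (HU n).
    rewrite Elast.
    destruct l2 as [|q' l2].
    { simpl. lra. }
    simpl in Hs. destruct Hs as [Hqq' Hs].
    rewrite last_cons_dflt.
    assert (Hr : dist Y q' (last l2 q') <= lsum (fun n => rho n + mu) (J1 ++ J2)).
    { apply IH; auto. intros r Hr. destruct (Hin r) as [m [Hm Hm']].
      { rewrite El. apply in_or_app. right. now right. }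
      exists m. split; auto. apply in_app_or in Hm. apply in_or_app. simpl in Hm.
      destruct Hm as [Hm|[<-|Hm]]; auto. exfalso. now apply (H r). }
    assert (T1 := dist_tri Y p (last l2 q') q). assert (T2 := dist_tri Y q (last l2 q') q'). lra.
Qed.

Lemma chain_dist (Y : Metric_Space) (U : nat -> Base Y -> Prop) (rho : nat -> R) (mu : R) J l p q :
  0 <= mu -> (forall n, 0 <= rho n) -> (forall n, diam_le Y (U n) (rho n)) ->
  (forall q, In q (p :: l) -> exists n, In n J /\ U n q) ->
  short_steps Y mu p l -> In q (p :: l) ->
  dist Y p q <= lsum (fun n => rho n + mu) J.
Proof.
  intros Hmu Hrho HU Hin Hl Hq.
  destruct Hq as [<-|Hq].
  - replace (dist Y p p) with 0 by (symmetry; now apply dist_refl).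
    apply lsum_nonneg. intro m. specialize (Hrho m). lra.
  - destruct (in_split q l Hq) as [l1 [l2 ->]].
    replace (l1 ++ q :: l2) with ((l1 ++ q :: nil) ++ l2) in * by now rewrite <- app_assoc.
    apply short_steps_app in Hl as [Hl _].
    replace q with (last (l1 ++ q :: nil) p) at 1 by apply last_last.
    eapply chain_end_dist; eauto. intros r Hr. apply Hin. simpl in *.
    destruct Hr as [->|Hr]; auto. right. apply in_or_app. auto.
Qed.

(* Eilenberg's inequality for finitely many intervals, through the mean value theorem: the derivative
   of 2 w atan((t - c) / w) is at least 1 on |t - c| <= w, and its total variation is 2 pi w. *)
Lemma light_level (l : list nat) (c w m : nat -> R) (a b : R) :
  a < b -> (forall n, 0 < w n) -> (forall n, 0 <= m n) ->
  exists t, a < t < b /\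
    lsum (fun n => if Rle_dec (Rabs (t - c n)) (w n) then m n else 0) l
      <= 8 * lsum (fun n => w n * m n) l / (b - a).
Proof.
  intros Hab Hw Hm.
  set (G := fun t => lsum (fun n => m n * (2 * w n * atan ((t - c n) / w n))) l).
  set (G' := fun t => lsum (fun n => m n * (2 / (1 + ((t - c n) / w n)^2))) l).
  assert (HG : forall t, derivable_pt_lim G t (G' t)).
  { intro t. unfold G, G'. induction l as [|n l' IH]; simpl.
    - apply derivable_pt_lim_const.
    - apply (derivable_pt_lim_plus (fun t => m n * (2 * w n * atan ((t - c n) / w n)))); [|exact IH].
      apply (derivable_pt_lim_scal (fun t => 2 * w n * atan ((t - c n) / w n))).
      replace (2 / (1 + (t - c n) / w n * ((t - c n) / w n * 1)))
        with (2 * w n * (/ (1 + ((t - c n) / w n)^2) * (/ w n))).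
      2:{ specialize (Hw n). field. split; [lra|].
          assert (0 < w n * w n) by now apply Rmult_lt_0_compat.
          assert (0 <= (t - c n) * (t - c n)) by apply Rle_0_sqr. lra. }
      apply (derivable_pt_lim_scal (fun t => atan ((t - c n) / w n))).
      apply (derivable_pt_lim_comp (fun t => (t - c n) / w n) atan).
      + replace (/ w n) with ((1 - 0) * / w n + (t - c n) * 0) by ring.
        apply (derivable_pt_lim_mult (fun t => t - c n) (fun _ => / w n)).
        * apply (derivable_pt_lim_minus (fun t => t) (fun _ => c n)).
          apply derivable_pt_lim_id. apply derivable_pt_lim_const.
        * apply derivable_pt_lim_const.
      + exact (derivable_pt_lim_atan _). }
  destruct (MVT_cor2 G G' a b Hab) as [t [E Ht]].
  { intros; apply HG. }
  exists t. split; auto.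
  apply Rle_trans with (G' t).
  - unfold G'. apply lsum_le. intros n _. specialize (Hw n). specialize (Hm n).
    assert (Hden : 0 < 1 + ((t - c n) / w n)^2) by (assert (0 <= ((t - c n) / w n)^2) by apply pow2_ge_0; lra).
    destruct (Rle_dec (Rabs (t - c n)) (w n)) as [H|H].
    + replace (m n) with (m n * 1) at 1 by ring. apply Rmult_le_compat_l; auto.
      apply Rmult_le_reg_r with (1 + ((t - c n) / w n)^2); auto.
      replace (2 / (1 + ((t - c n) / w n)^2) * (1 + ((t - c n) / w n)^2)) with 2
        by (generalize dependent ((t - c n) / w n); intros; field; lra).
      enough (((t - c n) / w n)^2 <= 1) by lra.
      rewrite <- pow2_abs. unfold Rdiv. rewrite Rabs_mult, Rabs_inv, (Rabs_pos_eq (w n)) by lra.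
      assert (Rabs (t - c n) * / w n <= 1).
      { apply Rmult_le_reg_r with (w n); auto. rewrite Rmult_assoc, Rinv_l by lra. lra. }
      assert (0 <= Rabs (t - c n) * / w n).
      { apply Rmult_le_pos; [apply Rabs_pos|]. left. now apply Rinv_0_lt_compat. }
      nra.
    + apply Rmult_le_pos; auto. apply Rlt_le. apply Rdiv_lt_0_compat; lra.
  - apply Rmult_le_reg_r with (b - a); [lra|].
    rewrite <- E. unfold Rdiv. rewrite Rmult_assoc, Rinv_l by lra. rewrite Rmult_1_r.
    unfold G. clear E HG. induction l as [|n l' IH]; simpl; [lra|].
    specialize (Hw n). specialize (Hm n). simpl in IH.
    set (u := (b - c n) / w n). set (v := (a - c n) / w n).
    assert (H1 := atan_bound u). assert (H2 := atan_bound v). assert (H3 := PI_4).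
    (* The constant 8 is the total variation factor $2\pi$ rounded up by [PI_4], that is $\pi \le
       4$. *)
    assert (m n * (2 * w n * atan u) - m n * (2 * w n * atan v) <= 8 * (w n * m n)).
    { replace (m n * (2 * w n * atan u) - m n * (2 * w n * atan v))
        with ((w n * m n) * (2 * (atan u - atan v))) by ring.
      replace (8 * (w n * m n)) with ((w n * m n) * 8) by ring.
      apply Rmult_le_compat_l; [apply Rmult_le_pos|]; lra. }
    lra.
Qed.

(** Paths are Lipschitz on all of [R]; the interval and the constraint on its points appear only in
    [joined]. Passing to a subpath then needs no change of [c]. *)
Definition is_path (X : Metric_Space) (c : R -> Base X) (K : R) : Prop :=
  0 <= K /\ forall s t, dist X (c s) (c t) <= K * Rabs (s - t).

Definition joined (X : Metric_Space) (P : Base X -> Prop) (x y : Base X) : Prop :=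
  exists (c : R -> Base X) (K a b : R),
    is_path X c K /\ a <= b /\ c a = x /\ c b = y /\ forall s, a <= s <= b -> P (c s).

(** * Lipschitz paths *)

Section Joined.
Context {X : Metric_Space}.
Implicit Types (P Q : Base X -> Prop) (x y z : Base X).

Lemma dist_self (M : Metric_Space) (p : Base M) : dist M p p = 0.
Proof. now apply dist_refl. Qed.

Lemma joined_along c K a b P :
  is_path X c K -> a <= b -> (forall s, a <= s <= b -> P (c s)) -> joined X P (c a) (c b).
Proof. intros. exists c, K, a, b. auto. Qed.

Lemma joined_refl P x : P x -> joined X P x x.
Proof.
  intro H. exists (fun _ => x), 0, 0, 0. repeat split; auto; try lra.
  intros s t. rewrite dist_self. lra.
Qed.

Lemma joined_mono P Q x y : (forall p, P p -> Q p) -> joined X P x y -> joined X Q x y.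
Proof. intros H [c [K [a [b [Hc [Hab [Ha [Hb HP]]]]]]]]. exists c, K, a, b. auto 10. Qed.

Lemma joined_sym P x y : joined X P x y -> joined X P y x.
Proof.
  intros [c [K [a [b [[HK Hc] [Hab [Ha [Hb HP]]]]]]]].
  exists (fun s => c (- s)), K, (- b), (- a). rewrite !Ropp_involutive.
  repeat split; auto; try lra.
  - intros s t. replace (s - t) with (- (- s - - t)) by ring. rewrite Rabs_Ropp. apply Hc.
  - intros s Hs. apply HP; lra.
Qed.

Lemma joined_trans P x y z : joined X P x y -> joined X P y z -> joined X P x z.
Proof.
  intros [c [K [a [b [[HK Hc] [Hab [Ha [Hb HP]]]]]]]] [c' [K' [a' [b' [[HK' Hc'] [Hab' [Ha' [Hb' HP']]]]]]]].
  exists (fun s => if Rle_dec s b then c s else c' (s - b + a')), (K + K'), a, (b + (b' - a')).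
  assert (Hx : forall s t, s <= b -> b < t ->
    dist X (c s) (c' (t - b + a')) <= (K + K') * Rabs (s - t)).
  { intros s t Hs Ht.
    assert (T := dist_tri X (c s) (c' (t - b + a')) (c b)).
    assert (H1 := Hc s b). rewrite Hb in *. rewrite <- Ha' in *.
    assert (H2 := Hc' a' (t - b + a')).
    rewrite Rabs_left1 in H1 by lra. rewrite Rabs_left1 in H2 by lra.
    rewrite (Rabs_left1 (s - t)) by lra.
    assert (0 <= K * (t - b)) by (apply Rmult_le_pos; lra).
    assert (0 <= K' * (b - s)) by (apply Rmult_le_pos; lra). lra. }
  repeat split; try lra.
  - intros s t. assert (A := Rabs_pos (s - t)).
    destruct (Rle_dec s b), (Rle_dec t b).
    + specialize (Hc s t). nra.
    + apply Hx; lra.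
    + rewrite dist_sym, Rabs_minus_sym. apply Hx; lra.
    + specialize (Hc' (s - b + a') (t - b + a')).
      replace (s - b + a' - (t - b + a')) with (s - t) in Hc' by ring. nra.
  - destruct (Rle_dec a b); [auto|lra].
  - destruct (Rle_dec (b + (b' - a')) b) as [H|H].
    + assert (b' = a') by lra. subst. replace (b + (a' - a')) with b by ring. congruence.
    + replace (b + (b' - a') - b + a') with b' by ring. auto.
  - intros s Hs. destruct (Rle_dec s b); [apply HP; lra|apply HP'; lra].
Qed.

Lemma joined_ends P x y : joined X P x y -> P x /\ P y.
Proof.
  intros [c [K [a [b [Hc [Hab [Ha [Hb HP]]]]]]]]. rewrite <- Ha, <- Hb. split; apply HP; lra.
Qed.

Lemma joined_hits P Q x y :
  joined X P x y -> ~ joined X (fun p => P p /\ ~ Q p) x y ->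
  exists q, Q q /\ P q /\ joined X P x q /\ joined X P q y.
Proof.
  intros [c [K [a [b [Hc [Hab [Ha [Hb HP]]]]]]]] H. apply NNPP. intro N. apply H.
  exists c, K, a, b. repeat split; auto; try apply Hc; try (apply HP; auto).
  intro Hq. apply N. exists (c s). repeat split; auto.
  - rewrite <- Ha. apply (joined_along c K); auto; [lra|]. intros; apply HP; lra.
  - rewrite <- Hb. apply (joined_along c K); auto; [lra|]. intros; apply HP; lra.
Qed.
End Joined.

(** * Filling a bigon *)

Lemma sin_lip a b : Rabs (sin a - sin b) <= Rabs (a - b).
Proof.
  assert (H : forall a b, a < b -> Rabs (sin b - sin a) <= Rabs (b - a)).
  { intros u v Huv. destruct (MVT_cor2 sin cos u v Huv) as [c [E _]].
    - intros. apply derivable_pt_lim_sin.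
    - rewrite E, Rabs_mult. assert (B := COS_bound c). assert (A := Rabs_pos (v - u)).
      assert (Rabs (cos c) <= 1) by (apply Rabs_le; lra).
      replace (Rabs (v - u)) with (1 * Rabs (v - u)) at 2 by ring. now apply Rmult_le_compat_r. }
  destruct (Rtotal_order a b) as [L|[->|L]].
  - rewrite (Rabs_minus_sym (sin a)), (Rabs_minus_sym a). now apply H.
  - rewrite !Rminus_diag. lra.
  - now apply H.
Qed.

Lemma cos_lip a b : Rabs (cos a - cos b) <= Rabs (a - b).
Proof.
  rewrite <- !sin_shift. eapply Rle_trans; [apply sin_lip|].
  replace (PI / 2 - a - (PI / 2 - b)) with (- (a - b)) by ring. rewrite Rabs_Ropp. lra.
Qed.

Lemma eucl_ge_fst p q : Rabs (fst p - fst q) <= eucl p q.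
Proof.
  unfold eucl. rewrite <- sqrt_Rsqr_abs. apply sqrt_le_1_alt. unfold Rsqr.
  assert (H := pow2_ge_0 (snd p - snd q)). lra.
Qed.

Lemma eucl_ge_snd p q : Rabs (snd p - snd q) <= eucl p q.
Proof.
  unfold eucl. rewrite <- sqrt_Rsqr_abs. apply sqrt_le_1_alt. unfold Rsqr.
  assert (H := pow2_ge_0 (fst p - fst q)). lra.
Qed.

Lemma eucl_le_l1 p q : eucl p q <= Rabs (fst p - fst q) + Rabs (snd p - snd q).
Proof.
  unfold eucl. assert (H1 := Rabs_pos (fst p - fst q)). assert (H2 := Rabs_pos (snd p - snd q)).
  rewrite <- (sqrt_Rsqr (Rabs (fst p - fst q) + Rabs (snd p - snd q))) by lra.
  apply sqrt_le_1_alt. rewrite <- (pow2_abs (fst p - fst q)), <- (pow2_abs (snd p - snd q)).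
  unfold Rsqr. nra.
Qed.

(** On this interval the parameter can be the first coordinate of a point of the unit circle. *)
Lemma joined_normalized (X : Metric_Space) (P : Base X -> Prop) x y :
  joined X P x y -> exists (c : R -> Base X) (K : R),
    is_path X c K /\ c (-1) = x /\ c 1 = y /\ forall s, -1 <= s <= 1 -> P (c s).
Proof.
  intros [c [K [a [b [[HK Hc] [Hab [Ha [Hb HP]]]]]]]].
  exists (fun s => c (a + (b - a) / 2 * (s + 1))), (K * ((b - a) / 2)).
  repeat split.
  - apply Rmult_le_pos; lra.
  - intros s t. eapply Rle_trans; [apply Hc|].
    replace (a + (b - a) / 2 * (s + 1) - (a + (b - a) / 2 * (t + 1))) with ((b - a) / 2 * (s - t)) by field.
    rewrite Rabs_mult, (Rabs_pos_eq ((b - a) / 2)) by lra. lra.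
  - rewrite <- Ha. f_equal. field.
  - rewrite <- Hb. f_equal. field.
  - intros s Hs. apply HP. nra.
Qed.

(** The delicate pairs lie on opposite half circles. As the paths agree at both ends, [A s] and
    [B s] are within $K(1-s^2)$, which is $K$ times the squared height of the circle over [s];
    heights are at most 1, and the height of either point is at most the distance of the two. *)
Lemma bigon_loop_lipschitz (X : Metric_Space) (A B : R -> Base X) (KA KB : R) :
  is_path X A KA -> is_path X B KB -> A (-1) = B (-1) -> A 1 = B 1 ->
  lipschitz_on_R2 X in_circle (fun p => if Rle_dec 0 (snd p) then A (fst p) else B (fst p))
    (2 * (KA + KB)).
Proof.
  intros [HKA HA] [HKB HB] E1 E2. set (K := KA + KB).
  assert (HAB : forall s, -1 <= s <= 1 -> dist X (A s) (B s) <= K * (1 - s * s)).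
  { intros s Hs. unfold K.
    assert (forall e, A e = B e -> dist X (A s) (B s) <= (KA + KB) * Rabs (s - e)) as He.
    { intros e Ee. specialize (HA s e). specialize (HB e s). rewrite (Rabs_minus_sym e s) in HB.
      assert (T := dist_tri X (A s) (B s) (A e)). rewrite Ee in *. lra. }
    destruct (Rle_or_lt 0 s).
    - specialize (He 1 E2). rewrite Rabs_left1 in He by lra.
      eapply Rle_trans; [exact He|]. apply Rmult_le_compat_l; [lra|nra].
    - specialize (He (-1) E1). rewrite Rabs_pos_eq in He by lra.
      eapply Rle_trans; [exact He|]. apply Rmult_le_compat_l; [lra|nra]. }
  assert (Hmix : forall p q, in_circle p -> in_circle q -> 0 <= snd p -> ~ 0 <= snd q ->
     dist X (A (fst p)) (B (fst q)) <= 2 * K * eucl p q).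
  { intros [p1 p2] [q1 q2] Hp Hq Hp2 Hq2. unfold in_circle in *. simpl in *.
    assert (N1 := eucl_ge_fst (p1, p2) (q1, q2)). assert (N2 := eucl_ge_snd (p1, p2) (q1, q2)).
    simpl in *. set (e := eucl (p1, p2) (q1, q2)) in *.
    assert (T := dist_tri X (A p1) (B q1) (A q1)).
    specialize (HA p1 q1). specialize (HAB q1).
    rewrite (Rabs_pos_eq (p2 - q2)) in N2 by lra.
    assert (0 <= K) by (unfold K; lra).
    assert (dist X (A q1) (B q1) <= K * e).
    { eapply Rle_trans; [apply HAB; nra|]. apply Rmult_le_compat_l; auto. nra. }
    assert (KA * Rabs (p1 - q1) <= K * e).
    { apply Rmult_le_compat; auto; [apply Rabs_pos|unfold K; lra]. }
    lra. }
  split; [unfold K; lra|]. intros p q Hp Hq. fold K.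
  assert (N1 := eucl_ge_fst p q). assert (H0 := Rabs_pos (fst p - fst q)).
  destruct (Rle_dec 0 (snd p)), (Rle_dec 0 (snd q)).
  - eapply Rle_trans; [apply HA|]. apply Rmult_le_compat; auto. unfold K; lra.
  - now apply Hmix.
  - rewrite dist_sym. eapply Rle_trans; [now apply Hmix|].
    replace (eucl q p) with (eucl p q); [lra|]. unfold eucl. f_equal. ring.
  - eapply Rle_trans; [apply HB|]. apply Rmult_le_compat; auto. unfold K; lra.
Qed.

(* The map (s, t) -> (sin th, sin ta cos th), with th = pi (s - 1/2) and ta = pi (t - 1/2), sends the
   square onto the disc, its top and bottom to the two half circles and its vertical sides to (-1, 0) and (1, 0). *)
Lemma bigon_filling (X Y : Metric_Space) (f : Base X -> Base Y) (Lam : R)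
  (PA PB : Base X -> Prop) (x y : Base X) :
  lipschitz X Y f Lam -> lip_simply_connected X -> purely_2_unrectifiable Y ->
  joined X PA x y -> joined X PB x y ->
  exists (G : R -> R -> Base X) (K : R),
    0 <= K /\
    (forall s t s' t', dist X (G s t) (G s' t') <= K * (Rabs (s - s') + Rabs (t - t'))) /\
    (forall t, G 0 t = x) /\ (forall t, G 1 t = y) /\
    (forall s, 0 <= s <= 1 -> PA (G s 1) /\ PB (G s 0)) /\
    hausdorff2_null Y (fun z => exists p, True /\ f (G (fst p) (snd p)) = z).
Proof.
  intros [HLam Hf] HX HY JA JB.
  destruct (joined_normalized _ _ _ _ JA) as [A [KA [HA [A0 [A1 HPA]]]]].
  destruct (joined_normalized _ _ _ _ JB) as [B [KB [HB [B0 [B1 HPB]]]]].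
  destruct (HX _ _ (bigon_loop_lipschitz X A B KA KB HA HB ltac:(congruence) ltac:(congruence)))
    as [F [L [[HL HF] HFg]]].
  set (th := fun s => PI * (s - 1 / 2)).
  set (G := fun s t => F (sin (th s), sin (th t) * cos (th s))).
  assert (HPI := PI_RGT_0).
  assert (Hth : forall s t, Rabs (th s - th t) = PI * Rabs (s - t)).
  { intros s t. unfold th. replace (PI * (s - 1/2) - PI * (t - 1/2)) with (PI * (s - t)) by ring.
    rewrite Rabs_mult, (Rabs_pos_eq PI); lra. }
  assert (Hdisc : forall s t, in_disc (sin (th s), sin (th t) * cos (th s))).
  { intros s t. unfold in_disc. simpl. assert (E1 := sin2_cos2 (th s)). assert (E2 := sin2_cos2 (th t)).
    unfold Rsqr in *. assert (0 <= cos (th t) * cos (th t)) by apply Rle_0_sqr.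
    assert (0 <= cos (th s) * cos (th s)) by apply Rle_0_sqr. nra. }
  assert (HG : forall s t s' t', dist X (G s t) (G s' t') <= L * (2 * PI) * (Rabs (s - s') + Rabs (t - t'))).
  { intros s t s' t'. unfold G. eapply Rle_trans; [apply HF; apply Hdisc|].
    rewrite Rmult_assoc. apply Rmult_le_compat_l; auto.
    eapply Rle_trans; [apply eucl_le_l1|]. simpl.
    assert (D1 := sin_lip (th s) (th s')). assert (D2 := cos_lip (th s) (th s')).
    assert (D3 := sin_lip (th t) (th t')). rewrite Hth in D1, D2, D3.
    replace (sin (th t) * cos (th s) - sin (th t') * cos (th s')) with
      (sin (th t) * (cos (th s) - cos (th s')) + cos (th s') * (sin (th t) - sin (th t'))) by ring.
    assert (B1' : Rabs (sin (th t)) <= 1) by (apply Rabs_le; apply SIN_bound).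
    assert (B2' : Rabs (cos (th s')) <= 1) by (apply Rabs_le; apply COS_bound).
    assert (T := Rabs_triang (sin (th t) * (cos (th s) - cos (th s'))) (cos (th s') * (sin (th t) - sin (th t')))).
    rewrite !Rabs_mult in T.
    assert (M1 : Rabs (sin (th t)) * Rabs (cos (th s) - cos (th s')) <= 1 * (PI * Rabs (s - s'))).
    { apply Rmult_le_compat; auto; apply Rabs_pos. }
    assert (M2 : Rabs (cos (th s')) * Rabs (sin (th t) - sin (th t')) <= 1 * (PI * Rabs (t - t'))).
    { apply Rmult_le_compat; auto; apply Rabs_pos. }
    assert (0 <= PI * Rabs (t - t')) by (apply Rmult_le_pos; [lra|apply Rabs_pos]). lra. }
  assert (S0 : sin (th 0) = -1 /\ cos (th 0) = 0).
  { unfold th. replace (PI * (0 - 1/2)) with (- (PI / 2)) by field.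
    rewrite sin_neg, cos_neg, sin_PI2, cos_PI2. lra. }
  assert (S1 : sin (th 1) = 1 /\ cos (th 1) = 0).
  { unfold th. replace (PI * (1 - 1/2)) with (PI / 2) by field. rewrite sin_PI2, cos_PI2. lra. }
  destruct S0 as [S0 C0], S1 as [S1 C1].
  exists G, (L * (2 * PI)). split; [apply Rmult_le_pos; lra|]. split; [exact HG|].
  split; [|split; [|split]].
  - intro t. unfold G. rewrite S0, C0, Rmult_0_r, HFg; simpl; [|unfold in_circle; simpl; ring].
    destruct (Rle_dec 0 0); [auto|lra].
  - intro t. unfold G. rewrite S1, C1, Rmult_0_r, HFg; simpl; [|unfold in_circle; simpl; ring].
    destruct (Rle_dec 0 0); [auto|lra].
  - intros s Hs. unfold G. rewrite S1, S0.
    assert (Hc : 0 <= cos (th s)). { apply cos_ge_0; unfold th; nra. }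
    assert (E := sin2_cos2 (th s)). unfold Rsqr in E. assert (Bs := SIN_bound (th s)).
    rewrite !HFg by (unfold in_circle; simpl; lra). simpl. split.
    + destruct (Rle_dec 0 (1 * cos (th s))); [|lra]. now apply HPA.
    (* At the two corners the bottom point has height 0, so the loop is evaluated through [A]; there
       [A] and [B] coincide. *)
    + destruct (Rle_dec 0 (-1 * cos (th s))) as [Hc'|Hc']; [|now apply HPB].
      assert (Z : cos (th s) = 0) by lra. rewrite Z in E.
      assert (sin (th s) = 1 \/ sin (th s) = -1) as [->| ->].
      { assert (Q : (sin (th s) - 1) * (sin (th s) + 1) = 0) by lra.
        apply Rmult_integral in Q. lra. }
      * replace (A 1) with (B 1) by congruence. apply HPB; lra.
      * replace (A (-1)) with (B (-1)) by congruence. apply HPB; lra.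
  (* The trigonometric map sends the whole plane into the disc, so the Borel set can be the plane,
     which is open. *)
  - apply (HY (fun _ => True) (fun p => f (G (fst p) (snd p))) (Lam * (L * (2 * PI) * 2))).
    + apply borel_open. intros p _. exists 1. split; [lra|auto].
    + assert (0 <= L * (2 * PI)) by (apply Rmult_le_pos; lra).
      split; [apply Rmult_le_pos; lra|]. intros p q _ _.
      eapply Rle_trans; [apply Hf|]. rewrite Rmult_assoc. apply Rmult_le_compat_l; auto.
      eapply Rle_trans; [apply HG|]. rewrite (Rmult_assoc _ 2). apply Rmult_le_compat_l; auto.
      assert (N1 := eucl_ge_fst p q). assert (N2 := eucl_ge_snd p q). lra.
Qed.

Lemma positive_lower_bound (rho : nat -> R) (N : nat) :
  (forall n, 0 < rho n) -> exists mu, 0 < mu /\ forall n, (n <= N)%nat -> mu <= rho n.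
Proof.
  intro H. induction N as [|N [mu [Hmu IH]]].
  - exists (rho 0%nat). split; auto. intros n Hn. replace n with 0%nat by lia. lra.
  - exists (Rmin mu (rho (S N))). split; [apply Rmin_glb_lt; auto|].
    intros n Hn. destruct (Nat.eq_dec n (S N)) as [->|]; [apply Rmin_r|].
    eapply Rle_trans; [apply Rmin_l|]. apply IH; lia.
Qed.

(** The sets of a Hausdorff cover need not be open. Thickening the [n]-th by [eta n] makes its
    preimage open and every diameter bound positive, while the added squares form a small geometric
    series; compactness of the square then leaves finitely many sets. *)
Lemma hausdorff2_null_finite_cover (Y : Metric_Space) (g : R -> R -> Base Y) (K kappa : R) :
  0 <= K -> 0 < kappa ->
  (forall s t s' t', dist Y (g s t) (g s' t') <= K * (Rabs (s - s') + Rabs (t - t'))) ->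
  hausdorff2_null Y (fun z => exists p, True /\ g (fst p) (snd p) = z) ->
  exists (N : nat) (U : nat -> Base Y -> Prop) (rho : nat -> R),
    (forall n, 0 < rho n) /\ (forall n, diam_le Y (U n) (rho n)) /\
    (forall s t, 0 <= s <= 1 -> 0 <= t <= 1 -> exists n, (n <= N)%nat /\ U n (g s t)) /\
    lsum (fun n => rho n * rho n) (seq 0 (S N)) <= kappa.
Proof.
  intros HK Hk Hg HH.
  destruct (HH 1 (kappa / 4)) as [U [r [HU [Hcov Hsum]]]]; [lra|lra|].
  (* From $(r+2\eta)^2 \le 2r^2+8\eta^2$ the sum is at most $2\kappa/4 + 16e^2$, and $e \le 1$ gives
     $e^2 \le e \le \kappa/32$. *)
  set (e := Rmin 1 (kappa / 32)).
  assert (He : 0 < e) by (apply Rmin_glb_lt; lra).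
  assert (He1 : e <= 1) by apply Rmin_l. assert (He2 : e <= kappa / 32) by apply Rmin_r.
  set (eta := fun n : nat => e * (1 / 2)^n).
  assert (Heta : forall n, 0 < eta n).
  { intro n. apply Rmult_lt_0_compat; auto. apply pow_lt; lra. }
  destruct (square_finite_subcover (fun n s t => exists y, U n y /\ dist Y y (g s t) < eta n)) as [N HN].
  - intros n s t [y [Hy Hd]]. exists ((eta n - dist Y y (g s t)) / (2 * (K + 1))).
    set (del := eta n - dist Y y (g s t)). assert (Hdel : 0 < del) by (unfold del; lra).
    split; [apply Rdiv_lt_0_compat; lra|]. intros s' t' Hs' Ht'. exists y. split; auto.
    assert (T := dist_tri Y y (g s' t') (g s t)). specialize (Hg s t s' t').
    rewrite (Rabs_minus_sym s), (Rabs_minus_sym t) in Hg.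
    assert (K * (Rabs (s' - s) + Rabs (t' - t)) < del); [|unfold del in *; lra].
    assert (E : 2 * (del / (2 * (K + 1))) * (K + 1) = del) by (field; lra).
    assert (A1 := Rabs_pos (s' - s)). assert (A2 := Rabs_pos (t' - t)).
    assert (Hh : 0 < del / (2 * (K + 1))) by (apply Rdiv_lt_0_compat; lra).
    set (h := del / (2 * (K + 1))) in *.
    apply Rle_lt_trans with (K * (2 * h)); [|lra]. apply Rmult_le_compat_l; lra.
  - intros s t Hs Ht. destruct (Hcov (g s t)) as [n Hn]; [now exists (s, t)|].
    exists n, (g s t). split; auto. now rewrite dist_self.
  - exists N, (fun n z => exists y, U n y /\ dist Y y z < eta n), (fun n => r n + 2 * eta n).
    split; [|split; [|split]].
    + intro n. destruct (HU n) as [H _]. specialize (Heta n). lra.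
    + intros n a b [y [Hy Hya]] [y' [Hy' Hyb]]. destruct (HU n) as [_ [_ HD]]. specialize (HD y y' Hy Hy').
      assert (T1 := dist_tri Y a b y). assert (T2 := dist_tri Y y b y'). rewrite (dist_sym Y a y) in T1. lra.
    + auto.
    + apply Rle_trans with (lsum (fun n => 2 * (r n)^2 + (8 * (e * e)) * (1/4)^n) (seq 0 (S N))).
      * apply lsum_le. intros n _.
        assert (E : eta n * eta n = (e * e) * (1/4)^n).
        { unfold eta. replace (1/4) with (1/2 * (1/2)) by field. rewrite Rpow_mult_distr. ring. }
        assert (S := Rle_0_sqr (r n - 2 * eta n)). unfold Rsqr in S. lra.
      * rewrite (lsum_lin (fun n => (r n)^2) (fun n => (1/4)^n)), !lsum_seq. specialize (Hsum N).
        assert (G : sum_f_R0 (fun n => (1/4)^n) N <= 2 - (1/4)^N).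
        { clear. induction N; simpl; [lra|]. assert (0 < (1/4)^N) by (apply pow_lt; lra). lra. }
        assert (0 < (1/4)^N) by (apply pow_lt; lra).
        assert (8 * (e * e) * sum_f_R0 (fun n => (1/4)^n) N <= 8 * (e * e) * 2).
        { apply Rmult_le_compat_l; [nra|lra]. }
        assert (e * e <= kappa / 32) by nra. lra.
Qed.

(** * Cut points and the tree metric *)

Section Fibres.
Context {X Y : Metric_Space} (f : Base X -> Base Y) (Lam : R).
Context (Lam_pos : 0 <= Lam) (f_lip : forall x x', dist Y (f x) (f x') <= Lam * dist X x x').

(** The centre [y] is free rather than [f p], which makes the relation symmetric at the same scale;
    composition recentres at the first [y] and pays $2e'$ for the second path. *)
Definition near (e : R) (p q : Base X) : Prop :=
  exists y, joined X (fun z => dist Y y (f z) < e) p q.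

Definition eqv (p q : Base X) : Prop := forall e, e > 0 -> near e p q.

Lemma near_mono e e' p q : e <= e' -> near e p q -> near e' p q.
Proof. intros H [y Hy]. exists y. revert Hy. apply joined_mono. intros; lra. Qed.

Lemma near_refl e p : e > 0 -> near e p p.
Proof. intro H. exists (f p). apply joined_refl. rewrite dist_self. lra. Qed.

Lemma near_sym e p q : near e p q -> near e q p.
Proof. intros [y Hy]. exists y. now apply joined_sym. Qed.

Lemma near_trans e e' p q r : near e p q -> near e' q r -> near (e + 2 * e') p r.
Proof.
  intros [y Hy] [y' Hy']. exists y.
  destruct (joined_ends _ _ _ Hy) as [_ Hq]. destruct (joined_ends _ _ _ Hy') as [Hq' _].
  assert (P := dist_pos Y y' (f q)).
  apply joined_trans with q.
  - revert Hy. apply joined_mono. intros; lra.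
  - revert Hy'. apply joined_mono. intros z Hz.
    assert (T1 := dist_tri Y y (f z) (f q)). assert (T2 := dist_tri Y (f q) (f z) y').
    rewrite (dist_sym Y (f q) y') in T2. lra.
Qed.

Lemma near_dist e p q : near e p q -> dist Y (f p) (f q) < 2 * e.
Proof.
  intros [y Hy]. destruct (joined_ends _ _ _ Hy) as [Hp Hq].
  assert (T := dist_tri Y (f p) (f q) y). rewrite (dist_sym Y (f p) y) in T. lra.
Qed.

Lemma joined_short_subpath c K s t : is_path X c K ->
  joined X (fun z => dist Y (f (c s)) (f z) <= Lam * (K * Rabs (s - t))) (c s) (c t).
Proof.
  intro Hc.
  assert (H : forall u, Rabs (s - u) <= Rabs (s - t) ->
    dist Y (f (c s)) (f (c u)) <= Lam * (K * Rabs (s - t))).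
  { intros u Hu. eapply Rle_trans; [apply f_lip|]. apply Rmult_le_compat_l; auto.
    eapply Rle_trans; [apply Hc|]. apply Rmult_le_compat_l; auto. apply Hc. }
  destruct (Rle_or_lt s t) as [Hst|Hst].
  - apply (joined_along c K); auto. intros u Hu. apply H. rewrite !Rabs_left1; lra.
  - apply joined_sym. apply (joined_along c K); auto; [lra|]. intros u Hu. apply H. rewrite !Rabs_pos_eq; lra.
Qed.

Lemma path_modulus c K e : is_path X c K -> e > 0 ->
  exists rho, rho > 0 /\ forall s t, Rabs (s - t) < rho ->
    joined X (fun z => dist Y (f (c s)) (f z) < e) (c s) (c t).
Proof.
  intros Hc He. assert (HK : 0 <= Lam * K) by (apply Rmult_le_pos; auto; apply Hc).
  exists (e / (Lam * K + 1)). split; [apply Rdiv_lt_0_compat; lra|].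
  intros s t Hst. generalize (joined_short_subpath c K s t Hc). apply joined_mono.
  intros p Hp. eapply Rle_lt_trans; [exact Hp|]. rewrite <- Rmult_assoc.
  apply Rle_lt_trans with (Lam * K * (e / (Lam * K + 1))).
  { apply Rmult_le_compat_l; lra. }
  apply Rmult_lt_reg_r with (Lam * K + 1); [lra|]. unfold Rdiv.
  rewrite !Rmult_assoc, Rinv_l by lra. nra.
Qed.

Lemma near_modulus c K e : is_path X c K -> e > 0 ->
  exists rho, rho > 0 /\ forall s t, Rabs (s - t) < rho -> near e (c s) (c t).
Proof.
  intros Hc He. destruct (path_modulus c K e Hc He) as [rho [Hr H]].
  exists rho. split; auto. intros s t Hst. exists (f (c s)). auto.
Qed.

Lemma eqv_refl p : eqv p p.
Proof. intros e He. now apply near_refl. Qed.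

Lemma eqv_sym p q : eqv p q -> eqv q p.
Proof. intros H e He. apply near_sym. auto. Qed.

Lemma eqv_trans p q r : eqv p q -> eqv q r -> eqv p r.
Proof.
  intros H H' e He. replace e with (e / 3 + 2 * (e / 3)) by field.
  apply near_trans with q; [apply H|apply H']; lra.
Qed.

Lemma near_eqv e e' p q r : e < e' -> near e p q -> eqv q r -> near e' p r.
Proof.
  intros He H H'. replace e' with (e + 2 * ((e' - e) / 2)) by field.
  apply near_trans with q; auto. apply H'; lra.
Qed.

Lemma not_eqv p q : ~ eqv p q -> exists e, e > 0 /\ ~ near e p q.
Proof.
  intro H. apply NNPP. intro N. apply H. intros e He. apply NNPP. intro N'. apply N. now exists e.
Qed.

Lemma eqv_dist p q : eqv p q -> dist Y (f p) (f q) = 0.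
Proof.
  intro H. assert (P := dist_pos Y (f p) (f q)).
  destruct (Rle_or_lt (dist Y (f p) (f q)) 0) as [|L]; [lra|].
  assert (dist Y (f p) (f q) < 2 * (dist Y (f p) (f q) / 2)) by (apply near_dist; apply H; lra). lra.
Qed.

(* Every Lipschitz path from x to y meets the class of z. *)
Definition cut (z x y : Base X) : Prop := ~ joined X (fun p => ~ eqv p z) x y.

Lemma cut_left x y : cut x x y.
Proof. intro H. destruct (joined_ends _ _ _ H) as [H' _]. apply H', eqv_refl. Qed.

Lemma cut_sym z x y : cut z x y -> cut z y x.
Proof. intros H H'. apply H. now apply joined_sym. Qed.

Lemma cut_right x y : cut y x y.
Proof. apply cut_sym, cut_left. Qed.

Lemma cut_or z x y w : cut z x y -> cut z x w \/ cut z w y.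
Proof.
  intro H. apply NNPP. intro N. apply not_or_and in N as [N1 N2].
  apply NNPP in N1. apply NNPP in N2. apply H. now apply joined_trans with w.
Qed.

Lemma cut_hit P z x y : cut z x y -> joined X P x y ->
  exists q, eqv q z /\ P q /\ joined X P x q /\ joined X P q y.
Proof.
  intros H HP. apply joined_hits; auto. intro N. apply H. revert N. apply joined_mono. tauto.
Qed.

Lemma cut_eqv z z' x y : eqv z z' -> cut z x y -> cut z' x y.
Proof.
  intros E H H'. apply H. revert H'. apply joined_mono. intros p Hp Hp'. apply Hp.
  now apply eqv_trans with z.
Qed.

(** If a path from [x] to [y'] avoids the class of [z], then [y'] is separated from [z] at some
    scale [e]. A connection from [y'] to [y] at scale [e / 3] cannot meet the class either, so it
    prolongs the path to [y]. *)
Lemma cut_eqv_right z x y y' : eqv y y' -> cut z x y -> cut z x y'.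
Proof.
  intros E H H'. destruct (joined_ends _ _ _ H') as [_ Hy'].
  destruct (not_eqv _ _ Hy') as [e [He N]].
  destruct (E (e / 3)) as [y0 Hy0]; [lra|]. apply joined_sym in Hy0.
  apply H. apply joined_trans with y'; auto. apply NNPP. intro N2. apply N.
  destruct (joined_hits _ (fun p => eqv p z) _ _ Hy0) as [q [Hq [_ [Hq' _]]]].
  { intro N3. apply N2. revert N3. apply joined_mono. tauto. }
  apply near_eqv with (e / 3) q; auto; [lra|]. now exists y0.
Qed.

Lemma cut_eqv_left z x x' y : eqv x x' -> cut z x y -> cut z x' y.
Proof. intros E H. apply cut_sym. apply cut_eqv_right with x; auto. now apply cut_sym. Qed.

(** A path from [x] to [y] that avoids [z] passes through the classes of [p] and [q]; its initial
    pieces up to these points, joined at [x], would connect the two classes without meeting [z]. *)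
Lemma cut_inner p q z x y : cut p x y -> cut q x y -> cut z p q -> cut z x y.
Proof.
  intros Hp Hq Hz H.
  destruct (cut_hit _ _ _ _ Hp H) as [p' [Ep [_ [Hxp _]]]].
  destruct (cut_hit _ _ _ _ Hq H) as [q' [Eq [_ [Hxq _]]]].
  assert (C : cut z p' q').
  { apply cut_eqv_left with p; [now apply eqv_sym|]. apply cut_eqv_right with q; auto. now apply eqv_sym. }
  apply C. apply joined_trans with x; auto. now apply joined_sym.
Qed.

(** Compactness of the parameter interval: inequivalence at each point persists nearby at a third of
    the scale. *)
Lemma joined_avoiding_uniform z x y :
  joined X (fun p => ~ eqv p z) x y -> exists del, del > 0 /\ joined X (fun p => ~ near del p z) x y.
Proof.
  intros [c [K [a [b [Hc [Hab [Ha [Hb HP]]]]]]]].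
  destruct (uniform_on_interval (fun del s => ~ near del (c s) z) a b) as [del [Hd H]].
  - intros del del' s Hdel H H'. apply H. apply near_mono with del'; auto; lra.
  - intros s Hs. destruct (not_eqv _ _ (HP s Hs)) as [e [He N]].
    destruct (near_modulus c K (e / 3) Hc) as [rho [Hrho Hm]]; [lra|].
    exists rho, (e / 3). repeat split; try lra.
    intros s' Hs' Hss' N'. apply N. replace e with (e / 3 + 2 * (e / 3)) by field.
    apply near_trans with (c s'); auto. apply Hm. now rewrite Rabs_minus_sym.
  - exists del. split; auto. exists c, K, a, b. auto 10.
Qed.

(** A path avoiding [p] avoids it by a margin [del], yet it meets the class of a cut point within
    [del / 3] of [p]. *)
Lemma cut_closed p x y :
  (forall del, del > 0 -> exists p', near del p' p /\ cut p' x y) -> cut p x y.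
Proof.
  intros H J. destruct (joined_avoiding_uniform _ _ _ J) as [del [Hd J']].
  destruct (H (del / 3)) as [p' [Hp C]]; [lra|].
  destruct (cut_hit _ _ _ _ C J') as [q [Eq [N _]]]. apply N.
  replace del with (del / 3 + 2 * (del / 3)) by field. apply near_trans with p'; auto.
  apply Eq; lra.
Qed.

Lemma joined_segment (G : R -> R -> Base X) (K s t s' t' : R) :
  0 <= K ->
  (forall s t s' t', dist X (G s t) (G s' t') <= K * (Rabs (s - s') + Rabs (t - t'))) ->
  joined X (fun z => dist Y (f (G s t)) (f z) <= Lam * (K * (Rabs (s - s') + Rabs (t - t'))))
    (G s t) (G s' t').
Proof.
  intros HK HG.
  assert (A1 := Rabs_pos (s - s')). assert (A2 := Rabs_pos (t - t')).
  assert (J := joined_short_subpath (fun u => G (s + u * (s' - s)) (t + u * (t' - t)))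
    (K * (Rabs (s - s') + Rabs (t - t'))) 0 1).
  simpl in J. replace (s + 0 * (s' - s)) with s in J by ring. replace (t + 0 * (t' - t)) with t in J by ring.
  replace (s + 1 * (s' - s)) with s' in J by ring. replace (t + 1 * (t' - t)) with t' in J by ring.
  replace (Rabs (0 - 1)) with 1 in J by (rewrite Rabs_left1; lra). rewrite Rmult_1_r in J.
  apply J. split; [apply Rmult_le_pos; lra|]. intros u v.
  eapply Rle_trans; [apply HG|]. rewrite Rmult_assoc. apply Rmult_le_compat_l; auto.
  replace (s + u * (s' - s) - (s + v * (s' - s))) with ((s' - s) * (u - v)) by ring.
  replace (t + u * (t' - t) - (t + v * (t' - t))) with ((t' - t) * (u - v)) by ring.
  rewrite !Rabs_mult, (Rabs_minus_sym s'), (Rabs_minus_sym t'). lra.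
Qed.

Fixpoint linked (mu : R) (p : Base X) (l : list (Base X)) : Prop :=
  match l with
  | nil => True
  | q :: l' => joined X (fun z => dist Y (f p) (f z) <= mu) p q /\ linked mu q l'
  end.

Lemma linked_short_steps mu l p : linked mu p l -> short_steps Y mu (f p) (map f l).
Proof.
  revert p. induction l as [|q l IH]; simpl; auto. intros p [H1 H2]. split; auto.
  now destruct (joined_ends _ _ _ H1).
Qed.

Lemma linked_joined mu l p y r : linked mu p l -> 0 <= mu ->
  (forall q, In q (p :: l) -> dist Y y (f q) <= r) ->
  joined X (fun z => dist Y y (f z) <= r + mu) p (last l p).
Proof.
  intros Hl Hmu. revert p Hl. induction l as [|q l IH]; intros p Hl Hr.
  - simpl. apply joined_refl. specialize (Hr p (or_introl eq_refl)). lra.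
  - destruct Hl as [Hpq Hl]. rewrite last_cons_dflt. apply joined_trans with q.
    + revert Hpq. apply joined_mono. intros z Hz. specialize (Hr p (or_introl eq_refl)).
      assert (T := dist_tri Y y (f z) (f p)). lra.
    + apply IH; auto. intros q' Hq'. apply Hr. now right.
Qed.

(** * Sublevel components and the existence of cut points *)

Definition reach (x : Base X) (t : R) (p : Base X) : Prop :=
  joined X (fun z => dist Y (f x) (f z) < t) x p.

Lemma reach_mono x t t' p : t <= t' -> reach x t p -> reach x t' p.
Proof. intro H. apply joined_mono. intros; lra. Qed.

Lemma reach_refl x t : 0 < t -> reach x t x.
Proof. intro H. apply joined_refl. rewrite dist_self. lra. Qed.

Context (X_simply_connected : lip_simply_connected X) (Y_unrectifiable : purely_2_unrectifiable Y).

(* Two paths from x to y bound a disc, on which the sublevel set [reach x t] separates the side x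
   from the side y.  For a suitable t its frontier, which joins the two paths, lies in the union of few
   members of a fine cover of the image, so that f moves little along it. *)
Lemma matching_points x y (PA PB : Base X -> Prop) t1 t2 e :
  joined X PA x y -> joined X PB x y -> 0 < t1 < t2 -> ~ reach x t2 y -> e > 0 ->
  exists p q, PA p /\ PB q /\ near e p q /\
    t1 <= dist Y (f x) (f p) /\ reach x t2 p /\ t1 <= dist Y (f x) (f q) /\ reach x t2 q.
Proof.
  intros JA JB Ht12 Hy He.
  destruct (bigon_filling X Y f Lam PA PB x y (conj Lam_pos f_lip) X_simply_connected
    Y_unrectifiable JA JB) as [G [K [HK [HG [G0 [G1 [GAB Gnull]]]]]]].
  (* With windows [2 * rho n], [light_level] yields $8\cdot 2\cdot\kappa/(t_2-t_1)$, which is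
     [e / 8] for this choice. *)
  destruct (hausdorff2_null_finite_cover Y (fun s t => f (G s t)) (Lam * K) (e * (t2 - t1) / 128))
    as [N [U [rho [Hrho [HU [Hcov Hsum]]]]]]; auto.
  { now apply Rmult_le_pos. }
  { apply Rdiv_lt_0_compat; [apply Rmult_lt_0_compat|]; lra. }
  { intros. eapply Rle_trans; [apply f_lip|]. rewrite Rmult_assoc. apply Rmult_le_compat_l; auto. }
  (* The level of some point of [U n], arbitrary if [U n] is empty; all levels in [U n] are within
     [rho n] of it. *)
  set (c := fun n => epsilon (inhabits 0) (fun r => exists y, U n y /\ r = dist Y (f x) y)).
  assert (Hc : forall n z, U n z -> Rabs (dist Y (f x) z - c n) <= rho n).
  { intros n z Hz. assert (S : exists y, U n y /\ c n = dist Y (f x) y).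
    { unfold c. apply epsilon_spec. now exists (dist Y (f x) z), z. }
    destruct S as [y' [Hy' ->]].
    assert (D := HU n z y' Hz Hy'). assert (T1 := dist_tri Y (f x) z y').
    assert (T2 := dist_tri Y (f x) y' z). rewrite (dist_sym Y y' z) in T1. apply Rabs_le. lra. }
  (* The windows are doubled because frontier vertices lie only within [mu] of level [t], and [mu]
     will be at most every [rho n] in use. *)
  destruct (light_level (seq 0 (S N)) c (fun n => 2 * rho n) rho t1 t2) as [t [Ht Hlight]].
  { lra. } { intro n. specialize (Hrho n). lra. } { intro n. specialize (Hrho n). lra. }
  assert (Hlight' : lsum (fun n => if Rle_dec (Rabs (t - c n)) (2 * rho n) then rho n else 0) (seq 0 (S N)) <= e / 8).
  { eapply Rle_trans; [exact Hlight|].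
    apply Rmult_le_reg_r with (t2 - t1); [lra|]. unfold Rdiv at 1. rewrite Rmult_assoc, Rinv_l, Rmult_1_r by lra.
    replace (lsum (fun n => 2 * rho n * rho n) (seq 0 (S N))) with (2 * lsum (fun n => rho n * rho n) (seq 0 (S N))).
    - lra.
    - rewrite <- (Rplus_0_r (2 * _)), <- (Rmult_0_l (lsum (fun n => rho n * rho n) (seq 0 (S N)))), <- lsum_lin.
      f_equal. extensionality n. ring. }
  clear Hlight Hsum.
  set (J := filter (fun n => if Rle_dec (Rabs (t - c n)) (2 * rho n) then true else false) (seq 0 (S N))).
  destruct (positive_lower_bound rho N Hrho) as [mu0 [Hmu0 Hmu0']].
  assert (HN : 0 < INR (S N)) by (apply lt_0_INR; lia).
  (* The bounds serve, in order, the doubled windows, the lower level [t1], the excursions between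
     consecutive vertices, and the total of the steps between different cover sets. *)
  assert (exists mu, 0 < mu /\ mu <= mu0 /\ mu <= t - t1 /\ mu <= e / 8 /\ mu * INR (S N) <= e / 8)
    as [mu [Hmu [Hm1 [Hm2 [Hm3 Hm4]]]]].
  { set (d := e / 8 / INR (S N)). assert (Hd : 0 < d) by (apply Rdiv_lt_0_compat; lra).
    exists (Rmin (Rmin mu0 (t - t1)) (Rmin (e / 8) d)).
    assert (R1 := Rmin_l (Rmin mu0 (t - t1)) (Rmin (e / 8) d)).
    assert (R2 := Rmin_r (Rmin mu0 (t - t1)) (Rmin (e / 8) d)).
    assert (R3 := Rmin_l mu0 (t - t1)). assert (R4 := Rmin_r mu0 (t - t1)).
    assert (R5 := Rmin_l (e / 8) d). assert (R6 := Rmin_r (e / 8) d).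
    split; [repeat apply Rmin_glb_lt; lra|]. repeat split; try lra.
    apply Rle_trans with (d * INR (S N)); [apply Rmult_le_compat_r; lra|].
    unfold d. unfold Rdiv at 1. rewrite Rmult_assoc, Rinv_l; lra. }
  assert (HJ : lsum (fun n => rho n + mu) J <= e / 4).
  { unfold J. rewrite lsum_filter.
    apply Rle_trans with (lsum (fun n => 1 * (if Rle_dec (Rabs (t - c n)) (2 * rho n) then rho n else 0) + 1 * mu) (seq 0 (S N))).
    - apply lsum_le. intros n _. destruct (Rle_dec (Rabs (t - c n)) (2 * rho n)); lra.
    - rewrite (lsum_lin _ (fun _ => mu)), lsum_const, length_seq. lra. }
  assert (HLK : 0 <= Lam * K) by now apply Rmult_le_pos.
  (* The factor 2 is for diagonal neighbours, whose coordinates differ by [/ INR M] each. *)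
  destruct (INR_unbounded (Lam * K * 2 / mu)) as [M' HM'].
  set (M := S M').
  assert (HM : 0 < INR M) by (apply lt_0_INR; unfold M; lia).
  assert (HMmu : Lam * K * 2 * / INR M <= mu).
  { apply Rmult_le_reg_r with (INR M); auto. rewrite Rmult_assoc, Rinv_l, Rmult_1_r by lra.
    unfold M. rewrite S_INR.
    assert (E : Lam * K * 2 / mu * mu = Lam * K * 2) by (field; lra). nra. }
  set (V := fun i j : nat => G (INR i / INR M) (INR j / INR M)).
  set (w := fun i j => if excluded_middle_informative (reach x t (V i j)) then true else false).
  assert (Hw : forall i j, w i j = true <-> reach x t (V i j)).
  { intros i j. unfold w. destruct (excluded_middle_informative (reach x t (V i j))); split; auto; discriminate. }
  assert (Hgrid : forall i, (i <= M)%nat -> 0 <= INR i / INR M <= 1).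
  { intros i Hi. apply le_INR in Hi. assert (0 <= INR i) by apply pos_INR. split.
    - apply Rmult_le_pos; auto. left. now apply Rinv_0_lt_compat.
    - apply Rmult_le_reg_r with (INR M); auto. unfold Rdiv. rewrite Rmult_assoc, Rinv_l; lra. }
  assert (Hclose : forall i i', close_idx i i' -> Rabs (INR i / INR M - INR i' / INR M) <= / INR M).
  { intros i i' [H1 H2]. apply le_INR in H1, H2. rewrite S_INR in *.
    replace (INR i / INR M - INR i' / INR M) with ((INR i - INR i') * / INR M) by (unfold Rdiv; ring).
    assert (P : 0 < / INR M) by now apply Rinv_0_lt_compat.
    rewrite Rabs_mult, (Rabs_pos_eq (/ INR M)) by lra.
    assert (Rabs (INR i - INR i') <= 1) by (apply Rabs_le; lra). nra. }
  assert (Hstep : forall i j i' j', close_idx i i' -> close_idx j j' ->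
    joined X (fun z => dist Y (f (V i j)) (f z) <= mu) (V i j) (V i' j')).
  { intros i j i' j' Hi Hj.
    generalize (joined_segment G K (INR i / INR M) (INR j / INR M) (INR i' / INR M) (INR j' / INR M) HK HG).
    apply joined_mono. intros z Hz. eapply Rle_trans; [exact Hz|]. eapply Rle_trans; [|exact HMmu].
    rewrite <- !Rmult_assoc. rewrite (Rmult_assoc (Lam * K)). apply Rmult_le_compat_l; auto.
    specialize (Hclose _ _ Hi) as C1. specialize (Hclose _ _ Hj) as C2. lra. }
  assert (Hfr : forall i j, frontier_vertex M M w i j ->
    reach x t (V i j) /\ t - mu <= dist Y (f x) (f (V i j)) /\ exists n, In n J /\ U n (f (V i j))).
  { intros i j [Hi [Hj [Hwij [i' [j' [Hi' [Hj' [Ci [Cj Hw']]]]]]]]].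
    apply Hw in Hwij.
    (* Below [t - mu] the short segment to the neighbour outside the component would stay under
       level [t] and put that neighbour inside. *)
    assert (Hlow : t - mu <= dist Y (f x) (f (V i j))).
    { apply Rnot_lt_le. intro L. assert (B : reach x t (V i' j')).
      { apply joined_trans with (V i j); auto. generalize (Hstep i j i' j' Ci Cj). apply joined_mono.
        intros z Hz. assert (T := dist_tri Y (f x) (f z) (f (V i j))). lra. }
      apply Hw in B. congruence. }
    split; auto. split; auto.
    destruct (Hcov (INR i / INR M) (INR j / INR M)) as [n [Hn HUn]]; auto.
    exists n. split; auto. unfold J. apply filter_In. split; [apply in_seq; lia|].
    destruct (Rle_dec (Rabs (t - c n)) (2 * rho n)) as [|C]; auto. exfalso. apply C.
    destruct (joined_ends _ _ _ Hwij) as [_ Hup]. specialize (Hc n _ HUn). fold (V i j) in Hc.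
    specialize (Hmu0' n Hn). apply Rabs_le.
    assert (A := Rle_abs (dist Y (f x) (f (V i j)) - c n)).
    assert (A' := Rle_abs (- (dist Y (f x) (f (V i j)) - c n))). rewrite Rabs_Ropp in A'. lra. }
  (* The predicate says that a chain of short steps leads to a frontier vertex of the top row with
     all images in the selected cover sets. A frontier neighbour inherits it by prepending itself,
     so some bottom vertex has it. *)
  destruct (frontier_crosses_grid M M w (fun i j => exists l, linked mu (V i j) l /\
      (exists i0, frontier_vertex M M w i0 M /\ last l (V i j) = V i0 M) /\
      forall q, In q (V i j :: l) -> exists n, In n J /\ U n (f q)))
    as [i [Hi [l [Hl [[i0 [Hi0 Hlast]] Hin]]]]].
  - intros j _. apply Hw. unfold V. simpl. unfold Rdiv at 1. rewrite Rmult_0_l, G0. apply reach_refl; lra.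
  - intros j _. destruct (w M j) eqn:E; auto. apply Hw in E. exfalso. apply Hy.
    apply reach_mono with t; [lra|]. unfold V in E. replace (INR M / INR M) with 1 in E by (field; lra).
    now rewrite G1 in E.
  - intros i Hi. exists nil. split; [exact I|]. split; [now exists i|].
    intros q [<-|[]]. now apply Hfr.
  - intros i j i' j' Ci Cj Fi Fi' [l [Hl [[i0 [Hi0 Hlast]] Hin]]].
    exists (V i j :: l). split; [|split].
    + split; auto. apply Hstep; unfold close_idx in *; lia.
    + exists i0. split; auto. now rewrite last_cons_dflt.
    + intros q [<-|Hq]; auto. now apply Hfr.
  - destruct (Hfr _ _ Hi) as [Ri [Li _]]. destruct (Hfr _ _ Hi0) as [Ri0 [Li0 _]].
    exists (V i0 M), (V i 0%nat).
    assert (EM : INR M / INR M = 1) by (field; lra).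
    assert (E0 : INR 0 / INR M = 0) by (change (INR 0) with 0; unfold Rdiv; ring).
    split; [|split; [|split; [|split; [|split; [|split]]]]]; try lra.
    + unfold V. rewrite EM. apply GAB, Hgrid, Hi0.
    + unfold V. rewrite E0. apply GAB, Hgrid, Hi.
    + apply near_sym. exists (f (V i 0%nat)).
      assert (D : joined X (fun z => dist Y (f (V i 0%nat)) (f z) <= e / 4 + mu) (V i 0%nat) (last l (V i 0%nat))).
      { apply linked_joined; auto; [lra|]. intros q Hq. eapply Rle_trans; [|exact HJ].
        apply (chain_dist Y U rho mu J (map f l)); auto; try lra.
        - intro n. specialize (Hrho n). lra.
        - intros q' Hq'. apply (in_map_iff f (V i 0%nat :: l)) in Hq' as [q0 [<- Hq0]]. auto.
        - now apply linked_short_steps.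
        - apply (in_map f (V i 0%nat :: l)). exact Hq. }
      rewrite Hlast in D. revert D. apply joined_mono. intros; lra.
    + apply reach_mono with t; auto; lra.
    + apply reach_mono with t; auto; lra.
Qed.

Lemma reach_extend x t e p q :
  reach x t p -> joined X (fun z => dist Y (f p) (f z) < e) p q -> reach x (t + e) q.
Proof.
  intros Hp Hq. destruct (joined_ends _ _ _ Hp) as [_ Hp']. destruct (joined_ends _ _ _ Hq) as [He _].
  rewrite dist_self in He. apply joined_trans with p.
  - apply reach_mono with t; auto; lra.
  - revert Hq. apply joined_mono. intros z Hz. assert (T := dist_tri Y (f x) (f z) (f p)). lra.
Qed.

Lemma near_reach x e p : near e x p -> reach x (2 * e) p.
Proof.
  intros [y Hy]. destruct (joined_ends _ _ _ Hy) as [Hx _].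
  revert Hy. apply joined_mono. intros z Hz. assert (T := dist_tri Y (f x) (f z) y).
  rewrite (dist_sym Y (f x) y) in T. lra.
Qed.

(** The last time in the intersection of the components [reach x t'] over [t' > t]. In the third
    clause one [t'] serves the whole tail after [s + eta], so there is a window of levels above [t]
    at which the path is inside the component only before time [s + eta]. *)
Definition last_visit (x : Base X) (c : R -> Base X) (a b t s : R) : Prop :=
  a <= s <= b /\ (forall t', t < t' -> reach x t' (c s)) /\
  forall eta, eta > 0 -> exists t', t < t' /\ forall s', s + eta <= s' <= b -> ~ reach x t' (c s').

Lemma last_visit_exists c K a b t :
  is_path X c K -> a <= b -> 0 < t -> exists s, last_visit (c a) c a b t s.
Proof.
  intros Hc Hab Ht. set (x := c a).
  destruct (sup_approx (fun s => a <= s <= b /\ forall t', t < t' -> reach x t' (c s)) b) as [s [Hub [Hsb Happ]]].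
  - exists a. split; [lra|]. intros. apply reach_refl; lra.
  - intros s [Hs _]; lra.
  - assert (Has : a <= s) by (apply Hub; split; [lra|]; intros; apply reach_refl; lra).
    exists s. split; [lra|]. split.
    + intros t' Ht'. destruct (path_modulus c K ((t' - t) / 2) Hc) as [rho [Hrho Hm]]; [lra|].
      destruct (Happ rho Hrho) as [s' [[Hs' Hr] Hss']].
      replace t' with ((t + t') / 2 + (t' - t) / 2) by field.
      apply reach_extend with (c s'); [apply Hr; lra|]. apply Hm.
      assert (s' <= s) by (apply Hub; auto). apply Rabs_def1; lra.
    + intros eta Heta.
      destruct (uniform_on_interval (fun del s' => ~ reach x (t + del) (c s')) (s + eta) b) as [del [Hdel H]].
      * intros d d' s' Hd H H'. apply H. apply reach_mono with (t + d'); auto; lra.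
      * intros s' Hs'. assert (N : exists t', t < t' /\ ~ reach x t' (c s')).
        { apply NNPP; intro N. assert (s' <= s); [|lra]. apply Hub. split; [lra|].
          intros t' Ht'. apply NNPP; intro N'. apply N. now exists t'. }
        destruct N as [t' [Ht' N]].
        destruct (path_modulus c K ((t' - t) / 2) Hc) as [rho [Hrho Hm]]; [lra|].
        exists rho, ((t' - t) / 2). repeat split; auto; [lra|]. intros s'' _ Hss H. apply N.
        replace t' with (t + (t' - t) / 2 + (t' - t) / 2) by field.
        apply reach_extend with (c s''); auto.
      * exists (t + del). split; [lra|]. auto.
Qed.

(** Replace each path up to its last visit by a connection below [t1]. The points that
    [matching_points] finds at level at least [t1] then lie on the tails, and lying in [reach x t2]
    forces them to be close in time to the last visits. *)
Lemma last_visits_eqv x y c K a b c' K' a' b' t t0 s s' :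
  is_path X c K -> is_path X c' K' -> c a = x -> c b = y -> c' a' = x -> c' b' = y ->
  0 < t < t0 -> ~ reach x t0 y -> last_visit x c a b t s -> last_visit x c' a' b' t s' ->
  eqv (c s) (c' s').
Proof.
  intros Hc Hc' Ea Eb Ea' Eb' Ht Hy [Hs [Hr Hn]] [Hs' [Hr' Hn']] e He.
  destruct (near_modulus c K (e / 8) Hc) as [rho [Hrho Hm]]; [lra|].
  destruct (near_modulus c' K' (e / 8) Hc') as [rho' [Hrho' Hm']]; [lra|].
  destruct (Hn (rho / 2)) as [ta [Hta Na]]; [lra|].
  destruct (Hn' (rho' / 2)) as [tb [Htb Nb]]; [lra|].
  (* At levels up to [t2] neither late tail is reached, and neither is [y]; [t1] is taken strictly
     above [t] so that both last visits are reached below it. *)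
  set (t2 := Rmin t0 (Rmin ta tb)).
  assert (B1 : t2 <= t0) by apply Rmin_l.
  assert (B2 : t2 <= Rmin ta tb) by apply Rmin_r.
  assert (B3 := Rmin_l ta tb). assert (B4 := Rmin_r ta tb).
  assert (B5 : t < t2) by (repeat apply Rmin_glb_lt; lra).
  set (t1 := (t + t2) / 2). assert (B6 : t < t1 < t2) by (unfold t1; lra).
  destruct (matching_points x y
     (fun p => dist Y (f x) (f p) < t1 \/ exists u, s <= u <= b /\ p = c u)
     (fun p => dist Y (f x) (f p) < t1 \/ exists u, s' <= u <= b' /\ p = c' u) t1 t2 (e / 8))
    as [p [q [Pp [Pq [Hpq [Lp [Rp [Lq Rq]]]]]]]]; try lra.
  - apply joined_trans with (c s).
    + generalize (Hr t1 (proj1 B6)). apply joined_mono. auto.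
    + rewrite <- Eb. apply (joined_along c K); auto; [lra|]. intros u Hu. right. now exists u.
  - apply joined_trans with (c' s').
    + generalize (Hr' t1 (proj1 B6)). apply joined_mono. auto.
    + rewrite <- Eb'. apply (joined_along c' K'); auto; [lra|]. intros u Hu. right. now exists u.
  - intro H. apply Hy. apply reach_mono with t2; auto.
  - destruct Pp as [Pp|[u [Hu ->]]]; [lra|]. destruct Pq as [Pq|[v [Hv ->]]]; [lra|].
    assert (u < s + rho / 2).
    { apply Rnot_le_lt. intro. apply (Na u); [lra|]. apply reach_mono with t2; auto; lra. }
    assert (v < s' + rho' / 2).
    { apply Rnot_le_lt. intro. apply (Nb v); [lra|]. apply reach_mono with t2; auto; lra. }
    apply near_mono with (e / 8 + 2 * (e / 8) + 2 * (e / 8)); [lra|].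
    apply near_trans with (c' v).
    + apply near_trans with (c u); auto. apply Hm. apply Rabs_def1; lra.
    + apply Hm'. apply Rabs_def1; lra.
Qed.

Context (C : R) (X_paths : forall x y, exists (c : R -> Base X) (L : R),
  is_path X c 1 /\ 0 <= L <= C * dist X x y /\ c 0 = x /\ c L = y).

(** The last visit at a small level on one path is the cut point: any other path from [x] to [y] has
    its own last visit in the same class. *)
Lemma exists_cut_nearby x y del : ~ eqv x y -> del > 0 ->
  exists z, cut z x y /\ near del x z /\ ~ eqv x z.
Proof.
  intros Hxy Hdel. destruct (not_eqv _ _ Hxy) as [d [Hd Nd]].
  assert (Ny : ~ reach x d y) by (intro H; apply Nd; now exists (f x)).
  set (t := Rmin del d / 2).
  assert (Ht : 0 < t < del /\ t < d).
  { assert (A := Rmin_l del d). assert (B := Rmin_r del d).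
    assert (0 < Rmin del d) by (apply Rmin_glb_lt; lra). unfold t. lra. }
  destruct (X_paths x y) as [c [L [Hc [HL [Ec0 EcL]]]]].
  destruct (last_visit_exists c 1 0 L t Hc) as [s Hs]; [lra|lra|]. rewrite Ec0 in Hs.
  exists (c s). split; [|split].
  - intros [c' [K' [a' [b' [Hc' [Hab' [Ea' [Eb' Hav]]]]]]]].
    destruct (last_visit_exists c' K' a' b' t Hc' Hab') as [s' Hs']; [lra|]. rewrite Ea' in Hs'.
    apply (Hav s'); [apply Hs'|]. apply eqv_sym.
    apply (last_visits_eqv x y c 1 0 L c' K' a' b' t d); auto; lra.
  - destruct Hs as [_ [Hr _]]. exists (f x). apply Hr; lra.
  (* If the last visit were equivalent to [x], it would be reached below [t / 2], and a further
     piece of the path would add at most [t / 2], so [s] would not be last. *)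
  - intro E. destruct Hs as [Hs [Hr Hn]].
    assert (s < L).
    { destruct (Rle_lt_or_eq_dec s L) as [|E']; [lra|auto|]. exfalso. apply Ny. rewrite <- EcL, <- E'. apply Hr; lra. }
    destruct (path_modulus c 1 (t / 2) Hc) as [rho [Hrho Hm]]; [lra|].
    set (s2 := Rmin L (s + rho / 2)).
    assert (B1 : s2 <= L) by apply Rmin_l. assert (B2 : s2 <= s + rho / 2) by apply Rmin_r.
    assert (B3 : s < s2) by (apply Rmin_glb_lt; lra).
    destruct (Hn (s2 - s)) as [t' [Ht' N]]; [lra|]. apply (N s2); [lra|].
    apply reach_mono with (2 * (t / 4) + t / 2); [lra|]. apply reach_extend with (c s).
    + apply near_reach. apply E; lra.
    + apply Hm. apply Rabs_def1; lra.
Qed.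

Lemma exists_cut_between x y : ~ eqv x y -> exists z, cut z x y /\ ~ eqv x z /\ ~ eqv z y.
Proof.
  intro Hxy. destruct (not_eqv _ _ Hxy) as [d [Hd Nd]].
  destruct (exists_cut_nearby x y (d / 2) Hxy) as [z [Cz [Nz Ez]]]; [lra|].
  exists z. repeat split; auto. intro E. apply Nd. apply near_eqv with (d / 2) z; auto; lra.
Qed.

Lemma cut_closed_along c K x y s : is_path X c K ->
  (forall rho, rho > 0 -> exists s', Rabs (s' - s) < rho /\ cut (c s') x y) -> cut (c s) x y.
Proof.
  intros Hc H. apply cut_closed. intros del Hdel.
  destruct (near_modulus c K del Hc Hdel) as [rho [Hrho Hm]].
  destruct (H rho Hrho) as [s' [Hs' Hcut]]. exists (c s'). auto.
Qed.

Lemma cut_hit_along c K a b z : is_path X c K -> a <= b -> cut z (c a) (c b) ->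
  exists s, a <= s <= b /\ eqv (c s) z.
Proof.
  intros Hc Hab H. apply NNPP. intro N. apply H. apply (joined_along c K); auto.
  intros s Hs E. apply N. now exists s.
Qed.

(** Take the last point [m] on a path from [x] to [y] that cuts both pairs at [x]. A path from [y]
    to [w] avoiding [m] does so by a margin, hence also avoids a cut point [z] of [m] and [y] close
    to [m]. Then [z] cuts [m] from [w] too, so it is a later common cut point. *)
Lemma cut_median x y w : exists m, cut m x y /\ cut m y w /\ cut m x w.
Proof.
  destruct (X_paths x y) as [c [L [Hc [HL [E0 EL]]]]].
  destruct (sup_approx (fun s => 0 <= s <= L /\ cut (c s) x y /\ cut (c s) x w) L) as [s [Hub [HsL Happ]]].
  - exists 0. rewrite E0. split; [lra|]. split; apply cut_left.
  - intros s [Hs _]; lra.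
  - assert (Hs0 : 0 <= s) by (apply Hub; rewrite E0; split; [lra|]; split; apply cut_left).
    assert (Happ' : forall rho, rho > 0 -> exists s', Rabs (s' - s) < rho /\ cut (c s') x y /\ cut (c s') x w).
    { intros rho Hrho. destruct (Happ rho Hrho) as [s' [[Hs' Hcut] Hss']]. exists s'. split; auto.
      assert (s' <= s) by (apply Hub; auto). apply Rabs_def1; lra. }
    assert (Hxy : cut (c s) x y).
    { apply (cut_closed_along c 1); auto. intros rho Hrho. destruct (Happ' rho Hrho) as [s' [? [? ?]]]. eauto. }
    assert (Hxw : cut (c s) x w).
    { apply (cut_closed_along c 1); auto. intros rho Hrho. destruct (Happ' rho Hrho) as [s' [? [? ?]]]. eauto. }
    exists (c s). split; auto. split; auto. intro Javoid.
    destruct (joined_avoiding_uniform _ _ _ Javoid) as [del [Hdel Jdel]].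
    set (m := c s) in *. assert (Nmy : ~ eqv m y).
    { intro E. destruct (joined_ends _ _ _ Javoid) as [H _]. apply H. now apply eqv_sym. }
    destruct (exists_cut_nearby m y (del / 2) Nmy) as [z [Cz [Nz Ez]]]; [lra|].
    assert (Cz' : cut z m w).
    { destruct (cut_or z m y w Cz) as [|Cwy]; auto. exfalso. apply cut_sym in Cwy. apply Cwy.
      revert Jdel. apply joined_mono. intros p Hp E. apply Hp. apply near_sym.
      apply near_eqv with (del / 2) z; auto; [lra|]. now apply eqv_sym. }
    destruct (cut_hit_along c 1 s L z Hc HsL) as [s' [Hs' E']]; [now rewrite EL|].
    assert (s' <= s).
    { apply Hub. split; [lra|]. split.
      - apply cut_eqv with z; [now apply eqv_sym|]. apply cut_inner with m y; auto. apply cut_right.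
      - apply cut_eqv with z; [now apply eqv_sym|]. apply cut_inner with m w; auto. apply cut_right. }
    assert (s' = s) by lra. subst s'. now apply Ez.
Qed.

(** * Chain length and its additivity at cut points *)

Inductive chain (e : R) : Base X -> Base X -> R -> Prop :=
  | chain_nil x : chain e x x 0
  | chain_cons x p y L : near e x p -> chain e p y L -> chain e x y (dist Y (f x) (f p) + L).

(** One [e] bounds both the mesh and the excess. Finer meshes admit fewer chains, so this bounds by
    [B] the limit of the infimal lengths as the mesh tends to 0. *)
Definition within (B : R) (x y : Base X) : Prop :=
  forall e, e > 0 -> exists L, L <= B + e /\ chain e x y L.

Lemma chain_app e x y z L L' : chain e x y L -> chain e y z L' -> chain e x z (L + L').
Proof.
  intros H H'. induction H as [x|x p y L Hxp Hp IH].
  - now rewrite Rplus_0_l.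
  - rewrite Rplus_assoc. constructor; auto.
Qed.

Lemma chain_step e x y : near e x y -> chain e x y (dist Y (f x) (f y)).
Proof. intro H. rewrite <- (Rplus_0_r (dist _ _ _)). apply chain_cons; auto. constructor. Qed.

Lemma chain_rev e x y L : chain e x y L -> chain e y x L.
Proof.
  intro H. induction H as [x|x p y L Hxp Hp IH]; [constructor|].
  rewrite Rplus_comm, dist_sym. apply chain_app with p; auto. apply chain_step. now apply near_sym.
Qed.

Lemma chain_length_ge e x y L : chain e x y L -> dist Y (f x) (f y) <= L.
Proof.
  intro H. induction H as [x|x p y L Hxp Hp IH]; [rewrite dist_self; lra|].
  assert (T := dist_tri Y (f x) (f y) (f p)). lra.
Qed.

Lemma chain_mono e e' x y L : e <= e' -> chain e x y L -> chain e' x y L.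
Proof.
  intros He H. induction H; constructor; auto. now apply near_mono with e.
Qed.

Lemma within_trans B B' x y z : within B x y -> within B' y z -> within (B + B') x z.
Proof.
  intros H H' e He. destruct (H (e / 2)) as [L [HL HC]]; [lra|]. destruct (H' (e / 2)) as [L' [HL' HC']]; [lra|].
  exists (L + L'). split; [lra|]. apply chain_app with y; eapply chain_mono; try eassumption; lra.
Qed.

Lemma within_sym B x y : within B x y -> within B y x.
Proof. intros H e He. destruct (H e He) as [L [HL HC]]. exists L. split; auto. now apply chain_rev. Qed.

Lemma within_dist B x y : within B x y -> dist Y (f x) (f y) <= B.
Proof.
  intro H. apply Rnot_lt_le. intro N. destruct (H ((dist Y (f x) (f y) - B) / 2)) as [L [HL HC]]; [lra|].
  apply chain_length_ge in HC. lra.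
Qed.

Lemma within_along c K s t : is_path X c K -> within (Lam * (K * Rabs (s - t))) (c s) (c t).
Proof.
  intros Hc. set (D := Lam * (K * Rabs (s - t))).
  assert (HD : 0 <= D).
  { apply Rmult_le_pos; auto. apply Rmult_le_pos; [apply Hc|apply Rabs_pos]. }
  intros e He. destruct (INR_unbounded (D / e)) as [n Hn].
  assert (HSn : 0 < INR (S n)) by (apply lt_0_INR; lia).
  set (h := (t - s) / INR (S n)).
  assert (Hh : Lam * (K * Rabs h) = D / INR (S n)).
  { unfold h, D, Rdiv. rewrite Rabs_mult, (Rabs_pos_eq (/ INR (S n))), Rabs_minus_sym; [ring|].
    left. now apply Rinv_0_lt_compat. }
  assert (Hhe : D / INR (S n) < e).
  { apply Rmult_lt_reg_r with (INR (S n)); auto. unfold Rdiv. rewrite Rmult_assoc, Rinv_l, Rmult_1_r by lra.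
    rewrite S_INR. assert (D / e * e = D) by (field; lra). nra. }
  assert (Hchain : forall k : nat, exists L, L <= D / INR (S n) * INR k /\ chain e (c s) (c (s + INR k * h)) L).
  { induction k as [|k [L [HL HC]]].
    - exists 0. simpl. split; [lra|]. rewrite Rmult_0_l, Rplus_0_r. constructor.
    - assert (J := joined_short_subpath c K (s + INR k * h) (s + INR (S k) * h) Hc).
      rewrite (S_INR k) in *. replace (s + INR k * h - (s + (INR k + 1) * h)) with (- h) in J by ring.
      rewrite Rabs_Ropp, Hh in J.
      eexists. split; [|eapply chain_app; [exact HC|apply chain_step]].
      + destruct (joined_ends _ _ _ J) as [_ J']. lra.
      + exists (f (c (s + INR k * h))). revert J. apply joined_mono. intros; lra. }
  destruct (Hchain (S n)) as [L [HL HC]].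
  exists L. split.
  - unfold Rdiv in HL. rewrite Rmult_assoc, Rinv_l, Rmult_1_r in HL by lra. lra.
  - replace (s + INR (S n) * h) with t in HC; auto. unfold h. field. lra.
Qed.

(** Some single step has endpoints cut by [z], and its connecting path meets the class of [z] at a
    point [q]. Routing this step through [q] adds at most [2 * e] on either side, and passing from
    [q] to [z] is free because [f] agrees there. *)
Lemma chain_cut e x y L z : chain e x y L -> cut z x y -> e > 0 ->
  exists L1 L2, chain e x z L1 /\ chain e z y L2 /\ L1 + L2 <= L + 4 * e.
Proof.
  intros H Hz He. induction H as [x|x p y L Hxp Hp IH].
  - destruct (cut_hit (fun q => q = x) z x x Hz) as [q [E [-> _]]]; [now apply joined_refl|].
    assert (D := eqv_dist _ _ E).
    exists (dist Y (f x) (f z)), (dist Y (f z) (f x)). split; [|split].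
    + apply chain_step. apply E; lra.
    + apply chain_step. apply near_sym, E; lra.
    + rewrite (dist_sym Y (f z)). lra.
  - destruct (classic (cut z p y)) as [Hc|Hc].
    + destruct (IH Hc) as [L1 [L2 [H1 [H2 H3]]]].
      exists (dist Y (f x) (f p) + L1), L2. split; [|split]; auto; [constructor; auto|lra].
    + destruct (cut_or z x y p Hz) as [Hc'|]; [|contradiction].
      destruct Hxp as [y0 J]. destruct (cut_hit _ _ _ _ Hc' J) as [q [E [_ [Jq Jq']]]].
      assert (D := eqv_dist _ _ E).
      assert (Nxq : near e x q) by now exists y0. assert (Nqp : near e q p) by now exists y0.
      assert (D1 := near_dist _ _ _ Nxq). assert (D2 := near_dist _ _ _ Nqp).
      assert (D3 := dist_pos Y (f x) (f p)).
      eexists; eexists. split; [|split].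
      * eapply chain_cons; [exact Nxq|]. apply chain_step. apply E; lra.
      * eapply chain_cons; [apply near_sym, E; lra|]. eapply chain_cons; eauto.
      * rewrite (dist_sym Y (f z)). lra.
Qed.

(* The infimum of the B with [within B x y], which is attained. *)
Definition tree_dist (x y : Base X) : R :=
  epsilon (inhabits 0) (fun d => within d x y /\ forall B, within B x y -> d <= B).

Lemma within_path x y : within (Lam * (C * dist X x y)) x y.
Proof.
  destruct (X_paths x y) as [c [L [Hc [HL [E0 EL]]]]]. rewrite <- E0 at 2. rewrite <- EL at 2.
  intros e He. destruct (within_along c 1 0 L Hc e He) as [B [HB HC]]. exists B. split; auto.
  rewrite Rabs_left1 in HB by lra. assert (Lam * (1 * - (0 - L)) <= Lam * (C * dist X x y)); [|lra].
  apply Rmult_le_compat_l; auto; lra.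
Qed.

Lemma tree_dist_spec x y :
  within (tree_dist x y) x y /\ forall B, within B x y -> tree_dist x y <= B.
Proof.
  unfold tree_dist. apply epsilon_spec.
  destruct (inf_approx (fun B => within B x y) 0) as [m [Hm [_ Happ]]].
  - eexists. apply within_path.
  - intros B HB. apply within_dist in HB. assert (P := dist_pos Y (f x) (f y)). lra.
  - exists m. split; auto. intros e He. destruct (Happ (e / 2)) as [B [HB HBm]]; [lra|].
    destruct (HB (e / 2)) as [L [HL HC]]; [lra|]. exists L. split; [lra|].
    apply chain_mono with (e / 2); auto; lra.
Qed.

Lemma tree_dist_le B x y : within B x y -> tree_dist x y <= B.
Proof. apply tree_dist_spec. Qed.

Lemma tree_dist_ge x y : dist Y (f x) (f y) <= tree_dist x y.
Proof. apply within_dist, tree_dist_spec. Qed.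

Lemma tree_dist_pos x y : 0 <= tree_dist x y.
Proof. assert (H := tree_dist_ge x y). assert (P := dist_pos Y (f x) (f y)). lra. Qed.

Lemma tree_dist_sym x y : tree_dist x y = tree_dist y x.
Proof. apply Rle_antisym; apply tree_dist_le, within_sym, tree_dist_spec. Qed.

Lemma tree_dist_tri x y z : tree_dist x y <= tree_dist x z + tree_dist z y.
Proof. apply tree_dist_le. apply within_trans with z; apply tree_dist_spec. Qed.

Lemma tree_dist_eqv x y : eqv x y -> tree_dist x y = 0.
Proof.
  intro E. apply Rle_antisym; [|apply tree_dist_pos]. apply tree_dist_le. intros e He.
  exists (dist Y (f x) (f y)). rewrite (eqv_dist _ _ E) at 1. split; [lra|]. apply chain_step, E, He.
Qed.

Lemma tree_dist_self x : tree_dist x x = 0.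
Proof. apply tree_dist_eqv, eqv_refl. Qed.

Lemma tree_dist_cut z x y : cut z x y -> tree_dist x z + tree_dist z y = tree_dist x y.
Proof.
  intro Hz. apply Rle_antisym; [|apply tree_dist_tri]. apply Rnot_lt_le. intro N.
  set (g := tree_dist x z + tree_dist z y - tree_dist x y) in *. assert (Hg : 0 < g) by (unfold g; lra).
  assert (Hlow : forall p q, exists e, e > 0 /\ forall L, chain e p q L -> tree_dist p q - g / 4 < L).
  { intros p q. apply NNPP. intro K. assert (W : within (tree_dist p q - g / 4) p q).
    { intros e He. apply NNPP. intro K'. apply K. exists e. split; auto. intros L HL.
      apply Rnot_le_lt. intro HL'. apply K'. exists L. split; auto; lra. }
    apply tree_dist_le in W. lra. }
  destruct (Hlow x z) as [e1 [He1 H1]]. destruct (Hlow z y) as [e2 [He2 H2]].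
  (* The chain exceeds its infimum by [e] and splitting adds [4 * e], together at most [g / 4]; with
     the two deficits of [g / 4] this is still less than [g]. *)
  set (e := Rmin (g / 20) (Rmin e1 e2)).
  assert (B1 : e <= g / 20) by apply Rmin_l.
  assert (B2 : e <= Rmin e1 e2) by apply Rmin_r.
  assert (B3 := Rmin_l e1 e2). assert (B4 := Rmin_r e1 e2).
  assert (He : e > 0) by (repeat apply Rmin_glb_lt; lra).
  destruct (proj1 (tree_dist_spec x y) e He) as [L [HL HC]].
  destruct (chain_cut e x y L z HC Hz He) as [L1 [L2 [C1 [C2 HLL]]]].
  assert (tree_dist x z - g / 4 < L1) by (apply H1; apply chain_mono with e; auto; lra).
  assert (tree_dist z y - g / 4 < L2) by (apply H2; apply chain_mono with e; auto; lra).
  unfold g in *. lra.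
Qed.

Lemma tree_dist_along c s t : is_path X c 1 -> tree_dist (c s) (c t) <= Lam * Rabs (s - t).
Proof.
  intro Hc. apply tree_dist_le. replace (Rabs (s - t)) with (1 * Rabs (s - t)) by ring. now apply within_along.
Qed.

(** Along a path, let [s1] be the last cut time at distance at most [r] and [s2] the infimum of the
    later cut times. If distance [r] is missed, these differ, and [exists_cut_between] produces a
    cut point that the path meets strictly between them. *)
Lemma exists_cut_at_dist x y r : 0 <= r <= tree_dist x y ->
  exists z, cut z x y /\ tree_dist x z = r.
Proof.
  intros Hr. destruct (X_paths x y) as [c [L [Hc [HL [E0 EL]]]]].
  assert (Hcont : forall s e, e > 0 -> exists rho, rho > 0 /\ forall s', Rabs (s' - s) < rho ->
     Rabs (tree_dist x (c s') - tree_dist x (c s)) < e).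
  { intros s e He. exists (e / (Lam + 1)). split; [apply Rdiv_lt_0_compat; lra|]. intros s' Hs'.
    assert (T1 := tree_dist_tri x (c s') (c s)). assert (T2 := tree_dist_tri x (c s) (c s')).
    rewrite (tree_dist_sym (c s) (c s')) in T1.
    assert (D := tree_dist_along c s' s Hc). assert (A := Rabs_pos (s' - s)).
    assert (E : e / (Lam + 1) * (Lam + 1) = e) by (field; lra).
    assert (Lam * Rabs (s' - s) < e) by nra. apply Rabs_def1; lra. }
  destruct (sup_approx (fun s => 0 <= s <= L /\ cut (c s) x y /\ tree_dist x (c s) <= r) L)
    as [s1 [Hub [Hs1L Happ]]].
  { exists 0. rewrite E0, tree_dist_self. repeat split; try lra. apply cut_left. }
  { intros s [Hs _]; lra. }
  assert (Hs1 : 0 <= s1).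
  { apply Hub. rewrite E0, tree_dist_self. repeat split; try lra. apply cut_left. }
  assert (Happ' : forall rho, rho > 0 -> exists s', Rabs (s' - s1) < rho /\ cut (c s') x y /\ tree_dist x (c s') <= r).
  { intros rho Hrho. destruct (Happ rho Hrho) as [s' [[Hs' Hcut] Hss']]. exists s'. split; auto.
    assert (s' <= s1) by (apply Hub; auto). apply Rabs_def1; lra. }
  assert (Hc1 : cut (c s1) x y).
  { apply (cut_closed_along c 1); auto. intros rho Hrho. destruct (Happ' rho Hrho) as [s' [? [? ?]]]. eauto. }
  assert (Hd1 : tree_dist x (c s1) <= r).
  { apply Rnot_lt_le. intro N. destruct (Hcont s1 (tree_dist x (c s1) - r)) as [rho [Hrho Hm]]; [lra|].
    destruct (Happ' rho Hrho) as [s' [Hs' [_ Hd]]]. specialize (Hm s' Hs'). apply Rabs_def2 in Hm. lra. }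
  destruct (Rle_lt_or_eq_dec _ _ Hd1) as [Hlt|Heq]; [|now exists (c s1)].
  exfalso.
  assert (Hs1L' : s1 < L).
  { destruct (Rle_lt_or_eq_dec _ _ Hs1L) as [|E]; auto. rewrite E, EL in Hlt. lra. }
  destruct (inf_approx (fun s => s1 < s <= L /\ cut (c s) x y) s1) as [s2 [Hlb [Hs12 Happ2]]].
  { exists L. rewrite EL. split; [lra|]. apply cut_right. }
  { intros s [Hs _]; lra. }
  assert (Hs2L : s2 <= L) by (apply Hlb; rewrite EL; split; [lra|]; apply cut_right).
  assert (Hbig : forall s, s1 < s <= L -> cut (c s) x y -> r < tree_dist x (c s)).
  { intros s Hs Hcs. apply Rnot_le_lt. intro N. assert (s <= s1); [|lra]. apply Hub. repeat split; auto; lra. }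
  (* Otherwise cut times would accumulate at [s1] from the right; their distances exceed [r],
     against continuity at [s1], where the distance is below [r]. *)
  assert (Hgap : s1 < s2).
  { destruct (Rle_lt_or_eq_dec _ _ Hs12) as [|E]; auto. exfalso.
    destruct (Hcont s1 (r - tree_dist x (c s1))) as [rho [Hrho Hm]]; [lra|].
    destruct (Happ2 rho Hrho) as [s [[Hs Hcs] Hss]].
    assert (Hm' := Hm s ltac:(apply Rabs_def1; lra)). apply Rabs_def2 in Hm'.
    specialize (Hbig s Hs Hcs). lra. }
  assert (Hc2 : cut (c s2) x y).
  { apply (cut_closed_along c 1); auto. intros rho Hrho. destruct (Happ2 rho Hrho) as [s [Hs Hss]].
    exists s. assert (s2 <= s) by (apply Hlb; auto). split; [apply Rabs_def1; lra|apply Hs]. }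
  assert (N12 : ~ eqv (c s1) (c s2)).
  { intro E. apply tree_dist_eqv in E. assert (T := tree_dist_tri x (c s2) (c s1)).
    assert (r < tree_dist x (c s2)) by (apply Hbig; auto; lra). lra. }
  destruct (exists_cut_between _ _ N12) as [z [Cz [N1 N2]]].
  destruct (cut_hit_along c 1 s1 s2 z Hc) as [s [Hs E]]; auto.
  assert (s <> s1) by (intros ->; auto).
  assert (s2 <= s).
  { apply Hlb. split; [lra|]. apply cut_eqv with z; [now apply eqv_sym|].
    apply cut_inner with (c s1) (c s2); auto. }
  assert (s = s2) by lra. subst s. apply N2. now apply eqv_sym.
Qed.
End Fibres.

(** * Arc length parametrization *)

Lemma poly_length_snoc (X : Metric_Space) (g : R -> Base X) l a t :
  poly_length X g a (l ++ t :: nil) = poly_length X g a l + dist X (g (last l a)) (g t).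
Proof.
  revert a. induction l as [|u l IH]; intro a; [simpl; lra|].
  rewrite last_cons_dflt. simpl. rewrite IH. lra.
Qed.

Lemma partition_snoc a b t l : Defs.partition a b l -> b <= t -> Defs.partition a t (l ++ t :: nil).
Proof.
  intros [Hi Hl] Ht. split; [|apply last_last]. subst b. revert a Hi Ht.
  induction l as [|u l IH]; intros a Hi Ht; [simpl in *; auto|].
  rewrite last_cons_dflt in Ht. destruct Hi as [Hu Hi]. split; auto.
Qed.

Lemma increasing_from_last_ge a l : increasing_from a l -> a <= last l a.
Proof.
  revert a. induction l as [|u l IH]; intros a Hi; [simpl; lra|]. destruct Hi as [Hu Hi].
  rewrite last_cons_dflt. specialize (IH u Hi). lra.
Qed.

Lemma length_le_trivial (X : Metric_Space) (g : R -> Base X) a : length_le X a a g 0.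
Proof.
  intros l [Hi Hl]. enough (poly_length X g a l = 0) by lra.
  induction l as [|u l IH]; [reflexivity|]. destruct Hi as [Hu Hi]. rewrite last_cons_dflt in Hl.
  assert (H := increasing_from_last_ge u l Hi). assert (u = a) by lra. subst u.
  simpl. rewrite dist_self, IH; auto. lra.
Qed.

Lemma length_le_weaken (X : Metric_Space) (g : R -> Base X) a t L L' :
  L <= L' -> length_le X a t g L -> length_le X a t g L'.
Proof. intros H HL l Hl. specialize (HL l Hl). lra. Qed.

(* The parameter s is sent to g (tau s), where tau s is the supremum of the t such that g has length
   at most s on [a, t].  This is 1-Lipschitz even before the length is known to be continuous in t. *)
Lemma arclength_parametrization (X : Metric_Space) (a b : R) (g : R -> Base X) (L : R) :
  a <= b -> 0 <= L -> continuous_on_interval X a b g -> length_le X a b g L ->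
  exists c, is_path X c 1 /\ c 0 = g a /\ c L = g b.
Proof.
  intros Hab HL Hg Hlen.
  set (E := fun s t => a <= t <= b /\ length_le X a t g s).
  set (is_tau := fun s m => (forall t, E s t -> t <= m) /\ m <= b /\
    forall rho, rho > 0 -> exists t, E s t /\ m - rho < t).
  set (tau := fun s => epsilon (inhabits 0) (is_tau s)).
  assert (Ea : forall s, 0 <= s -> E s a).
  { intros s Hs. split; [lra|]. apply length_le_weaken with 0; auto. apply length_le_trivial. }
  assert (Htau : forall s, 0 <= s -> is_tau s (tau s) /\ a <= tau s).
  { intros s Hs. assert (S : is_tau s (tau s)).
    { unfold tau. apply epsilon_spec. apply sup_approx; [exists a; auto|]. intros t [Ht _]; lra. }
    split; auto. apply S; auto. }
  assert (Hmain : forall s s', 0 <= s < s' -> dist X (g (tau s)) (g (tau s')) <= s' - s).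
  { intros s s' Hs. destruct (Htau s) as [[H1 [H2 H3]] H4]; [lra|].
    destruct (Htau s') as [[H1' [H2' H3']] H4']; [lra|].
    assert (Hmm : tau s <= tau s').
    { apply Rnot_lt_le. intro N. destruct (H3 (tau s - tau s')) as [t [[Ht Et] Ht']]; [lra|].
      assert (t <= tau s'); [|lra]. apply H1'. split; auto. apply length_le_weaken with s; auto; lra. }
    destruct (Rle_lt_or_eq_dec _ _ Hmm) as [Hlt|Heq].
    2:{ rewrite Heq, dist_self. lra. }
    apply Rnot_lt_le. intro N.
    set (e := (dist X (g (tau s)) (g (tau s')) - (s' - s)) / 2).
    assert (He : e > 0) by (unfold e; lra).
    destruct (Hg (tau s) ltac:(lra) e He) as [d [Hd Hc]].
    destruct (Hg (tau s') ltac:(lra) e He) as [d' [Hd' Hc']].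
    set (mid := (tau s + tau s') / 2).
    set (t1 := Rmin mid (tau s + d / 2)).
    assert (B1 : t1 <= mid) by apply Rmin_l. assert (B2 : t1 <= tau s + d / 2) by apply Rmin_r.
    assert (B3 : tau s < t1) by (apply Rmin_glb_lt; unfold mid; lra).
    assert (Hmid : tau s < mid < tau s') by (unfold mid; lra).
    destruct (H3' (Rmin d' (tau s' - mid))) as [t2 [E2 Ht2]]; [apply Rmin_glb_lt; lra|].
    assert (B4 := Rmin_l d' (tau s' - mid)). assert (B5 := Rmin_r d' (tau s' - mid)).
    assert (B6 := H1' t2 E2). destruct E2 as [Ht2' E2].
    (* Beyond [tau s] some inscribed polygon is longer than [s]; continued to [t2] it has length at
       most [s'], so the chord from [t1] to [t2] is shorter than [s' - s]. *)
    assert (exists l, Defs.partition a t1 l /\ s < poly_length X g a l) as [l [Hl Hpl]].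
    { apply NNPP. intro K. assert (t1 <= tau s); [|lra]. apply H1. split; [lra|].
      intros l Hl. apply Rnot_lt_le. intro. apply K. now exists l. }
    assert (P := E2 _ (partition_snoc a t1 t2 l Hl ltac:(lra))).
    rewrite poly_length_snoc in P. destruct Hl as [_ Hl]. rewrite Hl in P.
    assert (D1 : dist X (g t1) (g (tau s)) < e) by (apply Hc; [lra|apply Rabs_def1; lra]).
    assert (D2 : dist X (g t2) (g (tau s')) < e) by (apply Hc'; [lra|apply Rabs_def1; lra]).
    assert (T1 := dist_tri X (g (tau s)) (g (tau s')) (g t1)).
    assert (T2 := dist_tri X (g t1) (g (tau s')) (g t2)).
    rewrite (dist_sym X (g (tau s)) (g t1)) in T1. unfold e in *. lra. }
  exists (fun s => g (tau (Rmax 0 s))).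
  split; [|split].
  - split; [lra|]. intros s t. rewrite Rmult_1_l.
    assert (H : forall s t, s <= t -> dist X (g (tau (Rmax 0 s))) (g (tau (Rmax 0 t))) <= t - s).
    { clear s t. intros s t Hst. destruct (Rle_or_lt (Rmax 0 t) (Rmax 0 s)) as [H|H].
      - assert (E' : Rmax 0 s = Rmax 0 t) by (apply Rle_antisym; auto; apply Rle_max_compat_l; auto).
        rewrite E', dist_self. lra.
      - eapply Rle_trans; [apply Hmain; split; [apply Rmax_l|auto]|].
        unfold Rmax in *. destruct (Rle_dec 0 s), (Rle_dec 0 t); lra. }
    destruct (Rle_or_lt s t).
    + rewrite Rabs_left1 by lra. specialize (H s t). lra.
    + rewrite Rabs_pos_eq, dist_sym by lra. specialize (H t s). lra.
  (* [tau 0] exceeds [a] when [g] starts with a constant piece, so only the values of [g] can be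
     compared. *)
  - rewrite Rmax_left by lra. destruct (Htau 0 (Rle_refl 0)) as [[H1 [H2 H3]] H4].
    apply dist_refl. apply Rle_antisym; [|apply Rge_le, dist_pos].
    apply Rnot_lt_le. intro N.
    destruct (Hg (tau 0) ltac:(lra) _ N) as [d [Hd Hc]].
    destruct (H3 d Hd) as [t [Et Ht]]. assert (B := H1 t Et). destruct Et as [Ht' Et].
    assert (P := Et (t :: nil)). simpl in P.
    assert (P' : dist X (g a) (g t) + 0 <= 0) by (apply P; repeat split; simpl; lra).
    specialize (Hc t Ht' ltac:(apply Rabs_def1; lra)).
    assert (T := dist_tri X (g (tau 0)) (g a) (g t)).
    rewrite (dist_sym X (g (tau 0)) (g t)), (dist_sym X (g t) (g a)) in T. lra.
  - rewrite Rmax_right by lra. f_equal. destruct (Htau L HL) as [[H1 [H2 H3]] H4].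
    apply Rle_antisym; auto. apply H1. split; [lra|auto].
Qed.

Lemma quasi_convex_paths (X : Metric_Space) (C : R) : quasi_convex X C ->
  forall x y, exists (c : R -> Base X) (L : R),
    is_path X c 1 /\ 0 <= L <= C * dist X x y /\ c 0 = x /\ c L = y.
Proof.
  intros H x y. destruct (H x y) as [a [b [g [Hab [Hg [Ea [Eb Hlen]]]]]]].
  assert (HL : 0 <= C * dist X x y).
  { assert (P := Hlen (b :: nil)). simpl in P. assert (D := dist_pos X (g a) (g b)).
    assert (dist X (g a) (g b) + 0 <= C * dist X x y) by (apply P; repeat split; simpl; auto). lra. }
  destruct (arclength_parametrization X a b g _ Hab HL Hg Hlen) as [c [Hc [E0 EL]]].
  exists c, (C * dist X x y). rewrite E0, EL. repeat split; auto; try lra; apply Hc.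
Qed.

(** * Metric trees from betweenness *)

Section Betweenness.
Context (Z : Metric_Space) (B : Base Z -> Base Z -> Base Z -> Prop).
Context (B_dist : forall z x y, B z x y -> dist Z x z + dist Z z y = dist Z x y).
Context (B_or : forall z x y w, B z x y -> B z x w \/ B z w y).
Context (B_at : forall x y r, 0 <= r <= dist Z x y -> exists z, B z x y /\ dist Z x z = r).
Context (B_median : forall x y w, exists m, B m x y /\ B m y w /\ B m x w).

(** For the median [m] of [x], [p], [y] the three additivity relations give $2\,d(m,p)=0$. Hence [B]
    is exactly metric betweenness. *)
Lemma B_of_dist p x y : dist Z x p + dist Z p y = dist Z x y -> B p x y.
Proof.
  intro H. destruct (B_median x p y) as [m [H1 [H2 H3]]].
  assert (D := B_dist _ _ _ H3). apply B_dist in H1, H2.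
  rewrite (dist_sym Z p m) in H2. assert (E : m = p) by (apply dist_refl; lra). now subst m.
Qed.

(** By [B_or], [p] lies either between [x] and [q] or between [q] and [y]: points between [x] and
    [y] are ordered by their distance to [x]. *)
Lemma B_linear p q x y : B p x y -> B q x y -> dist Z p q = Rabs (dist Z x p - dist Z x q).
Proof.
  intros Hp Hq. assert (Dp := B_dist _ _ _ Hp). assert (Dq := B_dist _ _ _ Hq).
  assert (P := dist_pos Z p q).
  destruct (B_or p x y q Hp) as [H|H]; apply B_dist in H.
  - rewrite Rabs_left1; lra.
  - rewrite (dist_sym Z q p) in H. rewrite Rabs_pos_eq; lra.
Qed.

Lemma B_geodesic x y : exists g, geodesic Z x y g.
Proof.
  set (P := fun r z => B z x y /\ dist Z x z = r).
  exists (fun r => epsilon (inhabits x) (P r)).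
  assert (HP : forall r, 0 <= r <= dist Z x y -> P r (epsilon (inhabits x) (P r))).
  { intros r Hr. apply epsilon_spec. now apply B_at. }
  assert (D := dist_pos Z x y).
  split; [|split].
  - destruct (HP 0) as [_ H]; [lra|]. symmetry. now apply dist_refl.
  - destruct (HP (dist Z x y)) as [H1 H2]; [lra|]. apply B_dist in H1. apply dist_refl. lra.
  - intros s t Hs Ht. destruct (HP s Hs) as [H1 H2]. destruct (HP t Ht) as [H3 H4].
    rewrite (B_linear _ _ _ _ H1 H3), H2, H4. reflexivity.
Qed.

Lemma geodesic_point x y g r : geodesic Z x y g -> 0 <= r <= dist Z x y ->
  dist Z x (g r) = r /\ B (g r) x y.
Proof.
  intros [H0 [H1 H2]] Hr.
  assert (D1 := H2 0 r ltac:(lra) Hr). assert (D2 := H2 r (dist Z x y) Hr ltac:(lra)).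
  rewrite H0, Rabs_left1 in D1 by lra. rewrite H1, Rabs_left1 in D2 by lra.
  split; [lra|]. apply B_of_dist. lra.
Qed.

Definition on_leg (m v p : Base Z) : Prop := dist Z v p + dist Z p m = dist Z v m.

Lemma on_leg_same m v p q : on_leg m v p -> on_leg m v q ->
  dist Z p q = Rabs (dist Z m p - dist Z m q).
Proof.
  intros Hp Hq. rewrite (B_linear p q v m) by now apply B_of_dist. unfold on_leg in *.
  rewrite (dist_sym Z m p), (dist_sym Z m q), Rabs_minus_sym. f_equal. lra.
Qed.

(** Both points lie between [v] and [w], on different sides of [m], so [B_linear] applies. *)
Lemma on_leg_diff m v w p q : B m v w -> on_leg m v p -> on_leg m w q ->
  dist Z p q = dist Z m p + dist Z m q.
Proof.
  unfold on_leg. intros Hm Hp Hq. apply B_dist in Hm.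
  assert (S := dist_sym Z). rewrite (S w m), (S q m) in Hq. rewrite (S p m) in Hp.
  assert (T1 := dist_tri Z p w m). assert (T2 := dist_tri Z v w p).
  assert (T3 := dist_tri Z q v m). assert (T4 := dist_tri Z v w q).
  rewrite (S p m) in T1. rewrite (S q m), (S q v), (S m v) in T3. rewrite (S q w) in T4.
  rewrite (B_linear p q v w) by (apply B_of_dist; rewrite ?(S q w); lra).
  assert (P1 := dist_pos Z m p). assert (P2 := dist_pos Z m q).
  rewrite Rabs_left1; lra.
Qed.

Lemma on_leg_or m v w p : B m v w -> B p v w -> on_leg m v p \/ on_leg m w p.
Proof.
  intros Hm Hp. assert (D := B_linear p m v w Hp Hm). apply B_dist in Hm, Hp. unfold on_leg.
  assert (S := dist_sym Z). rewrite (S w p), (S w m).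
  destruct (Rle_or_lt (dist Z v p) (dist Z v m)).
  - left. rewrite Rabs_left1 in D; lra.
  - right. rewrite Rabs_pos_eq in D; lra.
Qed.

Lemma tripod_of_median (e : nat -> Base Z) (m : Base Z) (T : Base Z -> Prop) :
  (forall i j, (i < 3)%nat -> (j < 3)%nat -> i <> j -> B m (e i) (e j)) ->
  (forall p, T p -> exists i, (i < 3)%nat /\ on_leg m (e i) p) ->
  (forall i r, (i < 3)%nat -> 0 <= r <= dist Z (e i) m ->
     exists p, T p /\ on_leg m (e i) p /\ dist Z (e i) p = r) ->
  isometric_to_tripod Z T.
Proof.
  intros Hm HT Hsurj.
  set (idx := fun p => epsilon (inhabits 0%nat) (fun i => (i < 3)%nat /\ on_leg m (e i) p)).
  assert (Hidx : forall p, T p -> (idx p < 3)%nat /\ on_leg m (e (idx p)) p).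
  { intros p Hp. unfold idx. apply epsilon_spec. auto. }
  exists (fun i => dist Z m (e i)), (fun p => (idx p, dist Z m p)).
  split; [|split; [|split]].
  - intro i. apply Rge_le, dist_pos.
  - intros p Hp. destruct (Hidx p Hp) as [H1 H2]. unfold tripod_pt, on_leg in *. simpl. split; auto.
    assert (P1 := dist_pos Z m p). assert (P2 := dist_pos Z (e (idx p)) p).
    rewrite (dist_sym Z m (e _)), (dist_sym Z m p) in *. lra.
  - intros p p' Hp Hp'. destruct (Hidx p Hp) as [H1 H2]. destruct (Hidx p' Hp') as [H1' H2'].
    unfold tripod_dist. simpl. destruct (Nat.eqb_spec (idx p) (idx p')) as [E|E].
    + rewrite <- E in H2'. now apply on_leg_same with (e (idx p)).
    + apply on_leg_diff with (e (idx p)) (e (idx p')); auto.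
  - intros [i tt] [Hi Htt]. simpl in *. rewrite (dist_sym Z m) in Htt.
    destruct (Hsurj i (dist Z (e i) m - tt) Hi) as [p [Tp [Lp Dp]]]; [lra|].
    exists p. split; auto. destruct (Hidx p Tp) as [H1 H2].
    assert (E : dist Z m p = tt) by (unfold on_leg in Lp; rewrite (dist_sym Z m p); lra).
    unfold tripod_dist. simpl. destruct (Nat.eqb_spec (idx p) i) as [Ei|Ei].
    + rewrite E, Rminus_diag. apply Rabs_R0.
    (* A point on two different legs is the centre, whatever leg the choice [idx] assigned to it. *)
    + assert (D := on_leg_diff m (e (idx p)) (e i) p p (Hm _ _ H1 Hi Ei) H2 Lp).
      rewrite dist_self in D. lra.
Qed.

Lemma betweenness_metric_tree : metric_tree Z.
Proof.
  split; [exact B_geodesic|]. intros x y z g1 g2 g3 G1 G2 G3.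
  destruct (B_median x y z) as [m [Hxy [Hyz Hxz]]].
  set (e := fun i : nat => match i with O => x | S O => y | _ => z end).
  set (s := fun i : nat => match i with O => 1%nat | S O => 2%nat | _ => 0%nat end).
  set (g := fun i : nat => match i with O => g1 | S O => g2 | _ => g3 end).
  assert (Bs : forall v w, B m v w -> B m w v).
  { intros v w H. apply B_dist in H. apply B_of_dist.
    rewrite (dist_sym Z w m), (dist_sym Z m v), (dist_sym Z w v). lra. }
  assert (Hm : forall i j, (i < 3)%nat -> (j < 3)%nat -> i <> j -> B m (e i) (e j)).
  { intros i j Hi Hj Hij. destruct i as [|[|[|]]], j as [|[|[|]]]; try lia; simpl; auto. }
  assert (Hg : forall i, (i < 3)%nat -> geodesic Z (e i) (e (s i)) (g i)).
  { intros i Hi. destruct i as [|[|[|]]]; try lia; simpl; auto. }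
  assert (Hs : forall i, (i < 3)%nat -> (s i < 3)%nat /\ i <> s i).
  { intros i Hi. destruct i as [|[|[|]]]; simpl; lia. }
  apply (tripod_of_median e m); auto.
  - intros p Hp.
    assert (exists i t, (i < 3)%nat /\ 0 <= t <= dist Z (e i) (e (s i)) /\ g i t = p) as [i [t [Hi [Ht <-]]]].
    { destruct Hp as [[t Ht]|[[t Ht]|[t Ht]]]; [exists 0%nat|exists 1%nat|exists 2%nat]; exists t; simpl; auto with arith. }
    destruct (Hs i Hi) as [Hsi Hne]. destruct (geodesic_point _ _ _ _ (Hg i Hi) Ht) as [_ HB].
    destruct (on_leg_or m _ _ _ (Hm i (s i) Hi Hsi Hne) HB); eauto.
  - intros i r Hi Hr. destruct (Hs i Hi) as [Hsi Hne]. assert (HB := Hm i (s i) Hi Hsi Hne).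
    assert (D := B_dist _ _ _ HB). assert (P := dist_pos Z m (e (s i))).
    assert (Hr' : 0 <= r <= dist Z (e i) (e (s i))) by lra.
    destruct (geodesic_point _ _ _ _ (Hg i Hi) Hr') as [HD HB'].
    exists (g i r). split; [|split; auto].
    + destruct i as [|[|[|]]]; try lia; simpl in *; eauto.
    + unfold on_leg. rewrite (B_linear _ _ _ _ HB' HB), HD, Rabs_left1; lra.
Qed.
End Betweenness.

(** * The metric quotient and the factorization *)

(** [Metric_Space] identifies points at distance 0 by equality, so the quotient is realized as the
    subtype of chosen representatives. The choice is constant on classes because the predicates that
    define it are equal by extensionality. *)
Lemma pseudometric_quotient (T : Type) (d : T -> T -> R) :
  (forall x y, 0 <= d x y) -> (forall x y, d x y = d y x) -> (forall x, d x x = 0) ->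
  (forall x y z, d x y <= d x z + d z y) ->
  exists (Z : Metric_Space) (proj : T -> Base Z) (rep : Base Z -> T),
    (forall x y, dist Z (proj x) (proj y) = d x y) /\ (forall z, proj (rep z) = z).
Proof.
  intros Hpos Hsym Hself Htri.
  set (r := fun x => epsilon (inhabits x) (fun y => d x y = 0)).
  assert (Hr : forall x, d x (r x) = 0) by (intro x; apply (epsilon_spec (inhabits x)); now exists x).
  assert (Hd : forall x y, d (r x) (r y) = d x y).
  { intros x y. assert (A := Hr x). assert (A' := Hr y).
    assert (T1 := Htri x y (r x)). assert (T2 := Htri (r x) y (r y)).
    assert (T3 := Htri (r x) (r y) x). assert (T4 := Htri x (r y) y).
    rewrite (Hsym (r y) y) in T2. rewrite (Hsym (r x) x) in T3. lra. }
  assert (Hrr : forall x y, d x y = 0 -> r x = r y).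
  { intros x y E. unfold r.
    replace (fun z => d y z = 0) with (fun z => d x z = 0).
    - now rewrite (proof_irrelevance _ (inhabits x) (inhabits y)).
    - extensionality z. apply propositional_extensionality.
      assert (T1 := Htri x z y). assert (T2 := Htri y z x). rewrite (Hsym y x) in T2.
      assert (P1 := Hpos x z). assert (P2 := Hpos y z). split; intro; lra. }
  set (Zt := {x : T | r x = x}).
  assert (Z0 : forall u v : Zt, d (proj1_sig u) (proj1_sig v) = 0 <-> u = v).
  { intros [x Hx] [y Hy]. simpl. split.
    - intro E. assert (Exy : x = y) by (rewrite <- Hx, <- Hy; now apply Hrr). subst y.
      now rewrite (proof_irrelevance _ Hx Hy).
    - intro E. injection E as ->. apply Hself. }
  exists (Build_Metric_Space Zt (fun u v => d (proj1_sig u) (proj1_sig v))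
     (fun u v => Rle_ge _ _ (Hpos _ _)) (fun u v => Hsym _ _) Z0 (fun u v w => Htri _ _ _)).
  exists (fun x => exist (fun x => r x = x) (r x) (eq_sym (Hrr _ _ (Hr x)))), (@proj1_sig _ _).
  simpl. split; auto. intros [x Hx]. apply Z0. simpl. rewrite Hx. apply Hself.
Qed.

(** The infimum is attained: each difference quotient of [f] is a lower bound of the set of
    Lipschitz constants. *)
Lemma is_lip_const_lipschitz (X Y : Metric_Space) (f : Base X -> Base Y) (Lf : R) :
  (exists L, lipschitz X Y f L) -> is_lip_const X Y f Lf -> lipschitz X Y f Lf.
Proof.
  intros [L HL] [Hlow Hglb]. split.
  - apply Hglb. intros L' [H _]. exact H.
  - intros x y. assert (P := dist_pos X x y). destruct (Req_dec (dist X x y) 0) as [E|E].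
    + rewrite E. apply dist_refl in E. subst y. rewrite dist_self. lra.
    + assert (H : dist Y (f x) (f y) / dist X x y <= Lf).
      { apply Hglb. intros L' [_ H']. specialize (H' x y).
        apply Rmult_le_reg_r with (dist X x y); [lra|].
        unfold Rdiv. rewrite Rmult_assoc, Rinv_l by lra. lra. }
      apply Rmult_le_compat_r with (r := dist X x y) in H; [|lra].
      unfold Rdiv in H. rewrite Rmult_assoc, Rinv_l in H by lra. lra.
Qed.

(** [C] may be negative if [X] has at most one point, but then [Lf] is 0. *)
Lemma quasi_convex_lip_const_nonneg (X Y : Metric_Space) (C : R) (f : Base X -> Base Y) (Lf : R) :
  quasi_convex X C -> lipschitz X Y f Lf -> is_lip_const X Y f Lf -> 0 <= C * Lf.
Proof.
  intros HC [HLf Hf] [Hlow _].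
  destruct (classic (exists x y, 0 < dist X x y)) as [[x [y Hxy]]|N].
  - destruct (quasi_convex_paths X C HC x y) as [_ [L [_ [HL _]]]].
    apply Rmult_le_pos; auto. apply Rnot_lt_le. intro HC'. nra.
  - assert (Lf <= 0).
    { apply Hlow. split; [lra|]. intros x y. assert (E : x = y).
      { apply dist_refl. assert (P := dist_pos X x y). apply Rle_antisym; [|lra].
        apply Rnot_lt_le. intro. apply N. now exists x, y. }
      subst y. rewrite dist_self. lra. }
    assert (E : Lf = 0) by lra. rewrite E. lra.
Qed.

Theorem theorem7 (X Y : Metric_Space) (C : R) (f : Base X -> Base Y) (Lf : R) :
  quasi_convex X C ->
  lip_simply_connected X ->
  purely_2_unrectifiable Y ->
  (exists L, lipschitz X Y f L) ->
  is_lip_const X Y f Lf ->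
  exists (Z : Metric_Space) (psi : Base X -> Base Z) (phi : Base Z -> Base Y),
    metric_tree Z /\
    lipschitz X Z psi (C * Lf) /\
    lipschitz Z Y phi 1 /\
    (forall x, f x = phi (psi x)).
Proof.
  intros HC HX HY Hex HLf.
  assert (Hf := is_lip_const_lipschitz X Y f Lf Hex HLf).
  assert (HCL := quasi_convex_lip_const_nonneg X Y C f Lf HC Hf HLf).
  destruct Hf as [Lf_pos f_lip].
  assert (Hpaths := quasi_convex_paths X C HC).
  destruct (pseudometric_quotient (Base X) (tree_dist f)) as [Z [psi [rep [Hpsi Hrep]]]].
  { apply (tree_dist_pos f Lf Lf_pos f_lip C Hpaths). } { apply (tree_dist_sym f Lf Lf_pos f_lip C Hpaths). }
  { apply (tree_dist_self f Lf Lf_pos f_lip C Hpaths). } { apply (tree_dist_tri f Lf Lf_pos f_lip C Hpaths). }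
  assert (HZ : forall u v, dist Z u v = tree_dist f (rep u) (rep v)).
  { intros u v. now rewrite <- Hpsi, !Hrep. }
  exists Z, psi, (fun z => f (rep z)). split; [|split; [|split]].
  (* The ends are fixed representatives, while the middle point may be any preimage, since the
     constructions of cut points return points of [X]. *)
  - apply (betweenness_metric_tree Z (fun z x y => exists p, psi p = z /\ cut f p (rep x) (rep y))).
    + intros z x y [p [<- Hp]]. rewrite <- (Hrep x) at 1. rewrite <- (Hrep y) at 1. rewrite !Hpsi, HZ.
      now apply (tree_dist_cut f Lf Lf_pos f_lip C Hpaths).
    + intros z x y w [p [Ep Hp]]. destruct (cut_or f p _ _ (rep w) Hp); eauto.
    + intros x y r Hr. rewrite HZ in Hr.
      assert (H := exists_cut_at_dist f Lf Lf_pos f_lip HX HY C Hpaths (rep x) (rep y) r Hr).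
      destruct H as [p [Hp Hd]]. exists (psi p). split; [now exists p|].
      rewrite <- (Hrep x), Hpsi. exact Hd.
    + intros x y w.
      assert (H := cut_median f Lf Lf_pos f_lip HX HY C Hpaths (rep x) (rep y) (rep w)).
      destruct H as [p [H1 [H2 H3]]]. exists (psi p). eauto 10.
  - split; auto. intros x y. rewrite Hpsi.
    replace (C * Lf * dist X x y) with (Lf * (C * dist X x y)) by ring.
    apply (tree_dist_le f Lf Lf_pos f_lip C Hpaths). apply (within_path f Lf Lf_pos f_lip C Hpaths).
  - split; [lra|]. intros u v. rewrite Rmult_1_l, HZ. apply (tree_dist_ge f Lf Lf_pos f_lip C Hpaths).
  - intro x. apply dist_refl. apply Rle_antisym; [|apply Rge_le, dist_pos].
    eapply Rle_trans; [apply (tree_dist_ge f Lf Lf_pos f_lip C Hpaths)|]. rewrite <- Hpsi, Hrep, dist_self. lra.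
Qed.
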